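(* Let $Y$ be a rich solid QBF-space on $X$ and assume that the analyzing frame $\mathcal F=\{\varphi_x\}_{x\in X}$ has property $F(\nu,Y)$. For $r\in\{1,\dots,n\}$ let $\mathcal G_r=\{\psi^r_x\}_{x\in X}$ and $\tilde{\mathcal G}_r=\{\tilde\psi^r_x\}_{x\in X}$ be families in $\mathcal H$, and suppose that for some admissible covering $\mathcal U=\{U_i\}_{i\in I}$ with the additional property that $\mu(U_i)\ge D$ for all $i\in I$ and some constant $D>0$, the kernels $K_r:=K_{\mathcal U}[\mathcal G_r,\mathcal F]$ and $\tilde K_r^*:=K_{\mathcal U}^*[\tilde{\mathcal G}_r,\mathcal F]$ belong to $\mathcal B_{Y,m_\nu}$ for every $r\in\{1,\dots,n\}$. Then, if every $f\in\mathcal H$ has an expansion $$f=\sum_{r=1}^n\sum_{i\in I}\langle f,\tilde\psi^r_{x_i}\rangle\,\psi^r_{x_i}\qquad(\ast)$$ with fixed points $x_i\in U_i$, this expansion extends to all $f\in\mathrm{Co}(Y)=\mathrm{Co}(\mathcal F,Y)$. Furthermore, $f\in(\mathcal H_1^\nu)^\urcorner$ belongs to $\mathrm{Co}(Y)$ if and only if $\{\langle f,\tilde\psi^r_{x_i}\rangle\}_{i\in I}\in Y^\natural(\mathcal U)$ for each $r\in\{1,\dots,n\}$, and in this case we have $$\|f|\mathrm{Co}(Y)\|\asymp\sum_{r=1}^n\big\|\{\langle f,\tilde\psi^r_{x_i}\rangle\}_{i\in I}\big|Y^\natural(\mathcal U)\big\| .$$ The convergence in $(\ast)$ is in the quasi-norm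 of $\mathrm{Co}(Y)$ if the finite sequences are dense in $Y^\natural(\mathcal U)$. In general, we have weak*-convergence induced by $(\mathcal H_1^\nu)^\urcorner$.
   Context: Frame setting. $\mathcal H$ is a separable complex Hilbert space (inner product linear in the first argument); $X$ is a $\sigma$-compact locally compact Hausdorff space with a positive Radon measure $\mu$, $\operatorname{supp}\mu=X$. $\mathcal F=\{\varphi_x\}_{x\in X}\subset\mathcal H$ is a Parseval continuous frame: $x\mapsto\varphi_x$ is weakly measurable and $\|f|\mathcal H\|^2=\int_X|\langle f,\varphi_x\rangle|^2\,d\mu(x)$ for all $f\in\mathcal H$. Voice transform: $V_{\mathcal F}f(x)=\langle f,\varphi_x\rangle$. Frame kernel: $R_{\mathcal F}(x,y)=\langle\varphi_y,\varphi_x\rangle$. A measurable kernel $K:X\times X\to\mathbb C$ acts on functions by $K(F)(x)=\int_XK(x,y)F(y)\,d\mu(y)$. Weights. For a weight (measurable function) $\nu:X\to[1,\infty)$: $\|F|L_p^\nu\|=\|F\nu|L_p(X,\mu)\|$, $m_\nu(x,y)=\max\{\nu(x)/\nu(y),\nu(y)/\nu(x)\}$; $\mathcal A_1$ is the set of measurable $K$ with $\|K|\mathcal A_1\|=\max\{\operatorname{ess\,sup}_x\int|K(x,y)|d\mu(y),\operatorname{ess\,sup}_y\int|K(x,y)|d\mu(x)\}<\infty$; $\mathcal A_{m_\nu}=\{K:Km_\nu\in\mathcal A_1\}$, $\|K|\mathcal A_{m_\nu}\|=\|Km_\nu|\mathcal A_1\|$. $\mathcal H_1^\nu=\{f\in\mathcal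 H:V_{\mathcal F}f\in L_1^\nu(X)\}$ with norm $\|V_{\mathcal F}f|L_1^\nu\|$; $(\mathcal H_1^\nu)^\urcorner$ is its normed anti-dual (bounded conjugate-linear functionals), with duality product $\langle\cdot,\cdot\rangle$ extending the inner product of $\mathcal H$, so $\mathcal H_1^\nu\hookrightarrow\mathcal H\hookrightarrow(\mathcal H_1^\nu)^\urcorner$. Frame condition: (a) $\|\varphi_x|\mathcal H\|\le C_B\nu(x)$ for some constant $C_B>0$ and all $x\in X$; (b) $R_{\mathcal F}\in\mathcal A_{m_\nu}$. Under it $\varphi_x\in\mathcal H_1^\nu$ for a.e. $x$; by convention one assumes $\mathcal F\subset\mathcal H_1^\nu$. The voice transform extends to $(\mathcal H_1^\nu)^\urcorner$ by $V_{\mathcal F}f(x)=\langle f,\varphi_x\rangle$. Function spaces. A QBF-space $Y$ on $X$ is a linear space of ($\mu$-a.e. equivalence classes of) measurable functions on $X$, complete under a quasi-norm $\|\cdot|Y\|$. It is solid if $f$ measurable, $g\in Y$, $|f|\le|g|$ a.e. imply $f\in Y$ and $\|f|Y\|\le\|g|Y\|$; rich if $\chi_K\in Y$ for all compact $K\subset X$. $\mathcal B_{Y,m_\nu}$ is the set of $K\in\mathcal A_{m_\nu}$ that are bounded operators $Y\to Y$. Property $F(\nu,Y)$ (for a weight $\nu\ge1$): $\mathcal F$ satisfies the frame condition (a),(b), $R_{\mathcal F}:Y\to Y$ is continuous, and $R_{\mathcal F}(Y)\hookrightarrow L_\infty^{1/\nu}(X)$ continuously. In this case the coorbit is $\mathrm{Co}(Y)=\mathrm{Co}(\mathcal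 F,Y)=\{f\in(\mathcal H_1^\nu)^\urcorner:V_{\mathcal F}f\in Y\}$, $\|f|\mathrm{Co}(Y)\|=\|V_{\mathcal F}f|Y\|$. Coverings. A covering $\mathcal U=\{U_i\}_{i\in I}$ of $X$ is admissible if it is locally finite (each $x\in X$ has a neighborhood meeting only finitely many $U_i$), each $U_i$ is measurable, relatively compact, with non-void interior, and $\sup_{i}\sharp\{j:U_i\cap U_j\ne\emptyset\}<\infty$. (Then $I$ is countable.) $Y^\natural(\mathcal U)$ is the space of complex sequences $\{\lambda_i\}_{i\in I}$ with finite quasi-norm $\|\sum_i|\lambda_i|\mu(U_i)^{-1}\chi_{U_i}|Y\|$. Kernels. For a family $\mathcal G=\{\psi_x\}_{x\in X}\subset\mathcal H$, with $Q_y=\bigcup_{i:y\in U_i}U_i$: $K_{\mathcal U}[\mathcal G,\mathcal F](x,y)=\sup_{z\in Q_y}|\langle\varphi_x,\psi_z\rangle|$ and $K^*_{\mathcal U}[\mathcal G,\mathcal F](x,y)=K_{\mathcal U}[\mathcal G,\mathcal F](y,x)$. (The hypotheses on $K_r,\tilde K_r^*$ imply $\mathcal G_r,\tilde{\mathcal G}_r\subset\mathcal H_1^\nu$, so the pairings $\langle f,\tilde\psi^r_{x_i}\rangle$ make sense for $f\in(\mathcal H_1^\nu)^\urcorner$.) *)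

(* Defs.v *)
From HB Require Import structures.
From mathcomp Require Import all_boot all_order all_algebra.
From mathcomp Require Import all_classical all_reals all_analysis.
From mathcomp Require Import measurable_realfun ess_sup_inf finmap complex.
From mathcomp.analysis.showcase Require Import summability.

Set Implicit Arguments.
Unset Strict Implicit.
Unset Printing Implicit Defensive.
Import Order.TTheory GRing.Theory Num.Theory.
Import numFieldNormedType.Exports.
Local Open Scope classical_set_scope.
Local Open Scope ring_scope.

Notation borel X := (g_sigma_algebraType (@open X)).

Notation cabs := Normc.normc.

Section complex_integration.
Context {d : measure_display} {T : measurableType d} {R : realType}.
Implicit Types F : T -> R[i].

Definition cmeasurable F :=
  measurable_fun [set: T] (fun x => complex.Re (F x)) /\
  measurable_fun [set: T] (fun x => complex.Im (F x)).

Definition cintegrable (mu : {measure set T -> \bar R}) F :=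
  mu.-integrable [set: T] (fun x => (complex.Re (F x))%:E) /\
  mu.-integrable [set: T] (fun x => (complex.Im (F x))%:E).

Definition cintegral (mu : {measure set T -> \bar R}) F : R[i] :=
  Complex (fine (\int[mu]_x (complex.Re (F x))%:E))
          (fine (\int[mu]_x (complex.Im (F x))%:E)).

End complex_integration.

Definition sigma_compact (X : topologicalType) := exists K : nat -> set X,
  (forall n, compact (K n)) /\ \bigcup_n K n = [set: X].

Section space.
Context {X : ptopologicalType} {R : realType}.
Variable mu : {measure set (borel X) -> \bar R}.

Definition radon_measure := [/\
  forall K : set X, compact K -> (mu K < +oo)%E,
  forall A : set (borel X), measurable A ->
    mu A = ereal_inf [set mu V | V in [set V : set X | open V /\ A `<=` V]] &
  forall V : set X, open V ->
    mu V = ereal_sup [set mu K | K in [set K : set X | compact K /\ K `<=` V]]].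

Definition measure_support : set X :=
  [set x | forall V : set X, open V -> V x -> (0 < mu V)%E].

(* Elements are functions rather than classes: the space is saturated under
   a.e. equality, and the quasi-norm [qnorm] is only meaningful on [qbf]. *)
Record qbf_space := QBFSpace {
  qbf :> (borel X -> R[i]) -> Prop ;
  qnorm : (borel X -> R[i]) -> R ;
  qbf_measurable : forall F, qbf F -> cmeasurable F ;
  qbf_ae : forall F G, qbf F -> cmeasurable G ->
    (\forall x \ae mu, F x = G x) -> qbf G /\ qnorm G = qnorm F ;
  qbf0 : qbf (fun=> 0) ;
  qbf_linear : forall (a : R[i]) F G, qbf F -> qbf G ->
    qbf (fun x => a * F x + G x) ;
  qnorm_ge0 : forall F, qbf F -> 0 <= qnorm F ;
  qnorm_eq0 : forall F, qbf F -> qnorm F = 0 -> \forall x \ae mu, F x = 0 ;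
  qnormZ : forall (a : R[i]) F, qbf F ->
    qnorm (fun x => a * F x) = cabs a * qnorm F ;
  qnormD : exists C : R, forall F G, qbf F -> qbf G ->
    qnorm (fun x => F x + G x) <= C * (qnorm F + qnorm G) ;
  qbf_complete : forall F_ : nat -> borel X -> R[i], (forall n, qbf (F_ n)) ->
    (forall e : R, 0 < e -> exists N, forall m n, (N <= m)%N -> (N <= n)%N ->
      qnorm (fun x => F_ m x - F_ n x) < e) ->
    exists2 F, qbf F &
      (fun n => qnorm (fun x => F_ n x - F x)) @ \oo --> (0 : R) }.

Definition solid (Y : qbf_space) := forall F G : borel X -> R[i],
  cmeasurable F -> Y G -> (\forall x \ae mu, cabs (F x) <= cabs (G x)) ->
  Y F /\ qnorm Y F <= qnorm Y G.

Definition rich (Y : qbf_space) := forall K : set X, compact K ->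
  Y (fun x => (\1_K x : R)%:C%C).

Definition weight (nu : borel X -> R) :=
  measurable_fun [set: borel X] nu /\ forall x, 1 <= nu x.

Definition wLnorm (p : \bar R) (nu : borel X -> R) (F : borel X -> R[i]) :
    \bar R :=
  Lnorm mu p (fun x => (cabs (F x) * nu x)%:E).

Definition m_weight (nu : borel X -> R) (x y : borel X) : R :=
  Num.max (nu x / nu y) (nu y / nu x).

(* Norms are defined for [\bar R]-valued kernels, which stand for moduli: the
   kernels built from suprema below may take the value [+oo]. *)
Definition A1norm (K : borel X -> borel X -> \bar R) : \bar R :=
  maxe (ess_sup mu (fun x => \int[mu]_y `|K x y|)%E)
       (ess_sup mu (fun y => \int[mu]_x `|K x y|)%E).

Definition Amnorm (nu : borel X -> R) (K : borel X -> borel X -> \bar R) :=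
  A1norm (fun x y => K x y * (m_weight nu x y)%:E)%E.

Definition in_Am (nu : borel X -> R) (K : borel X -> borel X -> R[i]) :=
  cmeasurable (fun p : borel X * borel X => K p.1 p.2) /\
  (Amnorm nu (fun x y => (cabs (K x y))%:E) < +oo)%E.

Definition kernel_op (K : borel X -> borel X -> R[i]) (F : borel X -> R[i]) :
    borel X -> R[i] :=
  fun x => cintegral mu (fun y => K x y * F y).

(* [K] is a bounded operator [Y -> Y]; the integral defining [kernel_op K F]
   has to converge absolutely a.e., so that its values at the other points
   are irrelevant. *)
Definition bounded_on (Y : qbf_space) (K : borel X -> borel X -> R[i]) :=
  exists C : R, forall F, Y F ->
    [/\ \forall x \ae mu, cintegrable mu (fun y => K x y * F y),
        Y (kernel_op K F) & qnorm Y (kernel_op K F) <= C * qnorm Y F].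

(* Membership in B_{Y,m_nu} of a [0,+oo]-valued kernel. Finiteness of the norm
   makes [K] finite a.e., so [fine] only alters it on a null set. *)
Definition in_BYm (Y : qbf_space) (nu : borel X -> R)
    (K : borel X -> borel X -> \bar R) :=
  [/\ measurable_fun [set: borel X * borel X]
      (fun p : borel X * borel X => K p.1 p.2),
      (Amnorm nu K < +oo)%E &
      bounded_on Y (fun x y => (fine (K x y))%:C%C)].

Section coverings.
Context {I : choiceType}.
Variable U : I -> set X.

Definition admissible_covering := [/\
  \bigcup_i U i = [set: X],
  forall x : X, exists2 V, nbhs x V & finite_set [set i | U i `&` V !=set0],
  forall i, [/\ measurable (U i : set (borel X)), precompact (U i) &
                interior (U i) !=set0] &
  exists N : nat, forall i, ([set j | U i `&` U j !=set0] #<= `I_N)%card].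

Definition natural_fun (lambda : I -> R[i]) : borel X -> R[i] :=
  fun x => (\sum_(i \in [set: I])
              cabs (lambda i) * (fine (mu (U i)))^-1 * \1_(U i) x)%:C%C.

Definition natural_space (Y : qbf_space) : set (I -> R[i]) :=
  [set lambda | Y (natural_fun lambda)].

Definition natural_norm (Y : qbf_space) (lambda : I -> R[i]) : R :=
  qnorm Y (natural_fun lambda).

Definition finite_sequences_dense (Y : qbf_space) :=
  forall lambda, natural_space Y lambda -> forall e : R, 0 < e ->
  exists eta, [/\ finite_set [set i | eta i != 0], natural_space Y eta &
    natural_norm Y (fun i => lambda i - eta i) < e].

End coverings.

Section coorbit.
Variable H : completeNormedModType R[i].
(* linear in the first argument, conjugate-linear in the second *)
Variable dot : {dot H for (fun z : R[i] => z^*)}.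

Definition separable_hilbert_space :=
  (forall f, dot f f = `|f| ^+ 2) /\
  exists2 S : set H, countable S & dense S.

Definition parseval_frame (phi : borel X -> H) := forall f : H,
  cmeasurable (fun x => dot f (phi x)) /\
  (\int[mu]_x ((cabs (dot f (phi x))) ^+ 2)%:E
     = ((complex.Re `|f|) ^+ 2)%:E)%E.

(* The voice transform of a functional; [f : H] is identified with [dot f]. *)
Definition voice (phi : borel X -> H) (f : H -> R[i]) : borel X -> R[i] :=
  fun x => f (phi x).

Definition frame_kernel (phi : borel X -> H) : borel X -> borel X -> R[i] :=
  fun x y => dot (phi y) (phi x).

Definition H1 (phi : borel X -> H) (nu : borel X -> R) : set H :=
  [set f | (wLnorm 1 nu (voice phi (dot f)) < +oo)%E].

Definition H1norm (phi : borel X -> H) (nu : borel X -> R) (f : H) : R :=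
  fine (wLnorm 1 nu (voice phi (dot f))).

(* Only the values on [H1 phi nu] of a functional matter. *)
Definition antidual (phi : borel X -> H) (nu : borel X -> R) :
    set (H -> R[i]) :=
  [set f | (forall (a : R[i]) u v, H1 phi nu u -> H1 phi nu v ->
              f (a *: u + v) = a^* * f u + f v) /\
           exists C : R, forall u, H1 phi nu u ->
              cabs (f u) <= C * H1norm phi nu u].

Definition frame_condition (phi : borel X -> H) (nu : borel X -> R) :=
  (exists2 CB : R, 0 < CB & forall x, `|phi x| <= (CB * nu x)%:C%C) /\
  in_Am nu (frame_kernel phi).

Definition property_F (phi : borel X -> H) (nu : borel X -> R)
    (Y : qbf_space) := [/\
  weight nu,
  frame_condition phi nu,
  bounded_on Y (frame_kernel phi) &
  exists C : R, forall F, Y F ->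
    (wLnorm +oo (fun x => (nu x)^-1)%R (kernel_op (frame_kernel phi) F)
       <= (C * qnorm Y (kernel_op (frame_kernel phi) F))%:E)%E].

Definition coorbit (phi : borel X -> H) (nu : borel X -> R) (Y : qbf_space) :
    set (H -> R[i]) :=
  [set f | antidual phi nu f /\ Y (voice phi f)].

Definition coorbit_norm (phi : borel X -> H) (Y : qbf_space) (f : H -> R[i]) :
    R :=
  qnorm Y (voice phi f).

Definition sup_kernel {I : choiceType} (U : I -> set X) (psi phi : borel X -> H)
    (x y : borel X) : \bar R :=
  ereal_sup [set (cabs (dot (phi x) (psi z)))%:E
            | z in \bigcup_(i in [set i | U i y]) U i].

Definition sup_kernel_adj {I : choiceType} (U : I -> set X)
    (psi phi : borel X -> H) (x y : borel X) : \bar R :=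
  sup_kernel U psi phi y x.

Section expansions.
Context {n : nat} {I : choiceType}.
Variables (psi psit : 'I_n -> borel X -> H) (x_ : I -> X).

Definition expansion_term (f : H -> R[i]) (r : 'I_n) (i : I) : H :=
  f (psit r (x_ i)) *: psi r (x_ i).

(* The inner sums over the (countable, unordered) index set [I] converge
   unconditionally, i.e. along the directed set of finite subsets of [I]. *)

Definition expands_H (f : H) := exists2 g : 'I_n -> H,
  forall r, partial_sum (expansion_term (dot f) r) @ totally --> g r &
  f = \sum_r g r.

Definition expands_weakstar (phi : borel X -> H) (nu : borel X -> R)
    (f : H -> R[i]) := exists g : 'I_n -> H -> R[i], [/\
  forall r, antidual phi nu (g r),
  forall r h, H1 phi nu h ->
    (fun J => dot (partial_sum (expansion_term f r) J) h) @ totally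
      --> (g r h : R[i]^o) &
  forall h, H1 phi nu h -> f h = \sum_r g r h].

Definition expands_coorbit (phi : borel X -> H) (nu : borel X -> R)
    (Y : qbf_space) (f : H -> R[i]) := exists g : 'I_n -> H -> R[i], [/\
  forall r, coorbit phi nu Y (g r),
  forall r J,
    coorbit phi nu Y (dot (partial_sum (expansion_term f r) J)),
  forall r, (fun J => coorbit_norm phi Y
      (fun h => g r h - dot (partial_sum (expansion_term f r) J) h)) @ totally
      --> (0 : R) &
  forall h, H1 phi nu h -> f h = \sum_r g r h].

End expansions.
End coorbit.
End space.

(* Main.v *)
Require Import Defs.
From HB Require Import structures.
From mathcomp Require Import all_boot all_order all_algebra.
From mathcomp Require Import all_classical all_reals all_analysis.
From mathcomp Require Import finmap complex measurable_realfun ess_sup_inf.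
From mathcomp Require Import ring lra.
From mathcomp.analysis.showcase Require Import summability.

Set Implicit Arguments.
Unset Strict Implicit.
Unset Printing Implicit Defensive.
Import Order.TTheory GRing.Theory Num.Theory.
Import numFieldNormedType.Exports.
Local Open Scope classical_set_scope.
Local Open Scope ring_scope.

Local Notation Re := complex.Re.
Local Notation Im := complex.Im.

(** Write V h (x) = <h,phi_x>, let psi_i, psit_i be the sampled atoms of one of
the pairs of families, and let K, K~* be the two kernels of that pair. For
simplicity, suppose that there is only one pair. Read weakly, the expansion of
the elements of H is <u,h> = sum <u,psit_i> <psi_i,h>; taking conjugates and
exchanging the roles of u and h, it also says that h = sum <h,psi_i> psit_i
weakly.

For h in H_1^nu this dual series converges absolutely in H_1^nu. Indeed,
|<h,psi_i>| is at most the integral of |V h| against K(.,x) for every x in the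
cell U_i, and the norm of psit_i is at most a multiple of nu(x) for almost every
x in U_i, because K~* belongs to the weighted kernel algebra. Averaging the
product of the two bounds over U_i costs a factor 1/D, summing the averages
costs the overlap number of the covering, and what remains is an iterated
integral that Tonelli's theorem and the Schur bound for K estimate by the norm
of h [atoms_sum_bound]. A bounded conjugate-linear functional f on H_1^nu may
therefore be applied to the dual series term by term: f(h) is the sum of
f(psit_i) <psi_i,h> [antidual_expansion]. This is the weak*-expansion, and it
holds on the whole antidual.

The same absolute convergence gives |f(h)| <= int |V f| |V h| for h in H_1^nu
[antidual_abs_le]: the inequality holds for the partial sums of the expansion,
which lie in H, by Parseval, and the tails contribute arbitrarily little. With
h = psit_i the right-hand side is at most K~*(|V f|)(x) for every x in U_i, so
that the step function of the coefficients is dominated by K~*(|V f|)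
[natural_space_analysis]. Conversely, V of a series sum l_i psi_i is dominated
by the image under K of the step function of (l_i) [natural_space_synthesis].
As Y is solid and both kernels are bounded on Y, these two bounds give the
characterization of Co(Y) and the equivalence of the norms.

Applied to remainders, the second bound gives convergence in Co(Y) as soon as
the truncations of a sequence converge to it in the sequence space. By
solidity they do so whenever any finite sequences come close to it
[natural_space_tail]. *)

#[local] Existing Instance totally_filter.

(** * Modulus of complex numbers *)

Section modulus.
Context {R : realType}.
Implicit Types z w : R[i].

Lemma cabs_ge0 z : 0 <= cabs z.
Proof. by case: z => a b; exact: sqrtr_ge0. Qed.

Lemma cabsD z w : cabs (z + w) <= cabs z + cabs w.
Proof. exact: le_normcD. Qed.

Lemma cabsM z w : cabs (z * w) = cabs z * cabs w.
Proof. exact: Normc.normcM. Qed.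

Lemma cabsN z : cabs (- z) = cabs z.
Proof. exact: normcN. Qed.

Lemma cabs0 : cabs (0 : R[i]) = 0.
Proof. exact: Normc.normc0. Qed.

Lemma cabsC z w : cabs (z - w) = cabs (w - z).
Proof. by rewrite -opprB cabsN. Qed.

Lemma cabs_real (a : R) : cabs (a%:C)%C = `|a|.
Proof. by rewrite /= expr0n addr0 sqrtr_sqr. Qed.

Lemma cabs_conj z : cabs z^* = cabs z.
Proof. by case: z => a b /=; rewrite sqrrN. Qed.

Lemma cabs_triangle z w v : cabs (z - w) <= cabs (z - v) + cabs (v - w).
Proof. by rewrite (le_trans _ (cabsD _ _))// addrA subrK. Qed.

Lemma cabs_sum (J : Type) (s : seq J) (a : J -> R[i]) :
  cabs (\sum_(i <- s) a i) <= \sum_(i <- s) cabs (a i).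
Proof.
elim/big_ind2 : _ => [|z x w y zx wy|//]; first by rewrite cabs0.
by rewrite (le_trans (cabsD _ _)) ?lerD.
Qed.

Lemma ler_Re_cabs z : `|Re z| <= cabs z.
Proof. by rewrite -lecR; exact: normc_ge_Re. Qed.

Lemma ler_Im_cabs z : `|Im z| <= cabs z.
Proof.
case: z => a b /=; rewrite -sqrtr_sqr ler_wsqrtr// lerDr; exact: sqr_ge0.
Qed.

Lemma ler_cabs_ReIm z : cabs z <= `|Re z| + `|Im z|.
Proof.
case: z => a b /=; have h := addr_ge0 (normr_ge0 a) (normr_ge0 b).
rewrite -[leRHS]ger0_norm// -sqrtr_sqr ler_wsqrtr//.
rewrite sqrrD !real_normK ?num_real// -addrA [_ *+ 2 + _]addrC addrA lerDl.
by rewrite mulrn_wge0// mulr_ge0.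
Qed.

Lemma cabs_sqrE z : cabs z ^+ 2 = Re z ^+ 2 + Im z ^+ 2.
Proof. by case: z => a b /=; rewrite sqr_sqrtr// addr_ge0 ?sqr_ge0. Qed.

Lemma ler_norm_cabsB z w : `|cabs z - cabs w| <= cabs (z - w).
Proof.
rewrite ler_norml; apply/andP; split.
  rewrite lerNl opprB lerBlDr cabsC (le_trans _ (cabsD _ _))//.
  by rewrite subrK.
by rewrite lerBlDr (le_trans _ (cabsD _ _))// subrK.
Qed.

(** The integrand of the polarization identity, in the subtraction-free form
that survives integration against an infinite measure. *)
Lemma cabs_sqrD_le z w :
  cabs (z + w) ^+ 2 <= cabs (z - w) ^+ 2 + 4%:R * (cabs z * cabs w).
Proof.
have h : Re z * Re w + Im z * Im w <= cabs z * cabs w.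
  rewrite -[cabs w]cabs_conj -cabsM; apply: le_trans (ler_Re_cabs _).
  apply: le_trans (ler_norm _); case: z w => [a b] [c d] /=.
  by rewrite mulrN opprK.
rewrite !cabs_sqrE; case: z w h => [a b] [c d] /=; nra.
Qed.

End modulus.

(** * Limits of complex nets and unordered sums *)

Section unordered_sums.
Context {R : realType}.

(** Neighbourhoods in R[i] are indexed by positive elements of R[i] itself;
these are the positive reals, so that real tolerances suffice. *)
Lemma cvg_cabsP (T : Type) (F : set_system T) (FF : Filter F) (x : T -> R[i])
    (s : R[i]) :
  x @ F --> (s : R[i]^o) <->
  forall e : R, 0 < e -> \forall t \near F, cabs (x t - s) <= e.
Proof.
split=> [/(@cvgrPdistC_le _ (R[i]^o) _ F FF x s) xs e e0|xs].
  have := xs e%:C%C; rewrite ltcR => /(_ e0); apply: filterS => t.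
  by rewrite -lecR.
apply/(@cvgrPdistC_le _ (R[i]^o) _ F FF x s) => -[a b].
rewrite ltcE => /= /andP[/eqP -> a0].
by have := xs a a0; apply: filterS => t; rewrite -lecR.
Qed.

Lemma cvg_cabsB (T : Type) (F : set_system T) (FF : Filter F) (x : T -> R[i])
    (s w : R[i]) : x @ F --> (s : R[i]^o) ->
  (fun t => cabs (x t - w)) @ F --> cabs (s - w).
Proof.
move=> /cvg_cabsP xs; apply/cvgrPdistC_le => e e0.
have := xs e e0; apply: filterS => t; apply: le_trans.
rewrite (le_trans (ler_norm_cabsB _ _))//.
by rewrite opprB addrA subrK.
Qed.

Lemma cvg_Re_Im (T : Type) (F : set_system T) (FF : Filter F) (x : T -> R[i])
    (s : R[i]) : x @ F --> (s : R[i]^o) ->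
  (fun t => Re (x t)) @ F --> Re s /\ (fun t => Im (x t)) @ F --> Im s.
Proof.
move=> /cvg_cabsP xs; split; apply/cvgrPdistC_le => e e0;
  have := xs e e0; apply: filterS => t; apply: le_trans.
  rewrite (le_trans _ (ler_Re_cabs _))//.
  by case: (x t) => [a b]; case: (s) => [c d].
rewrite (le_trans _ (ler_Im_cabs _))//.
by case: (x t) => [a b]; case: (s) => [c d].
Qed.

Lemma cabs_lim_le (T : Type) (F : set_system T) (FF : ProperFilter F)
    (x : T -> R[i]) (s : R[i]) (M : R) : x @ F --> (s : R[i]^o) ->
  (\forall t \near F, cabs (x t) <= M) -> cabs s <= M.
Proof.
move=> /(fun h => @cvg_cabsB T F _ x s 0 h); rewrite subr0 => xs xM.
rewrite -(cvg_lim _ xs)//; apply: limr_le.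
  by apply/cvg_ex; exists (cabs s).
by apply: filterS xM => t; rewrite subr0.
Qed.

Lemma ccvg_unique (T : Type) (F : set_system T) (FF : ProperFilter F)
    (x : T -> R[i]) (s t : R[i]) :
  x @ F --> (s : R[i]^o) -> x @ F --> (t : R[i]^o) -> s = t.
Proof.
move=> /cvg_cabsP xs /cvg_cabsP xt; apply/eqP; rewrite -subr_eq0; apply/eqP.
apply: Normc.eq0_normc; apply/eqP; rewrite eq_le cabs_ge0 andbT.
apply/ler_addgt0Pr => e e0; rewrite add0r.
have e2 : 0 < e / 2 by rewrite divr_gt0.
have [z [zs zt]] := filter_ex (filterI (xs _ e2) (xt _ e2)).
by rewrite (le_trans (cabs_triangle _ _ (x z)))// [e]splitr lerD// cabsC.
Qed.

Lemma ccvg_lin (T : Type) (F : set_system T) (FF : Filter F)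
    (x y : T -> R[i]) (a s t : R[i]) :
  x @ F --> (s : R[i]^o) -> y @ F --> (t : R[i]^o) ->
  (fun z => a * x z + y z) @ F --> (a * s + t : R[i]^o).
Proof.
move=> /cvg_cabsP xs /cvg_cabsP yt; apply/cvg_cabsP => e e0.
have ca0 : 0 < cabs a + 1 by rewrite ltr_wpDl ?cabs_ge0.
have e2 : 0 < e / 2 by rewrite divr_gt0.
apply: filterS2 (xs _ (divr_gt0 e2 ca0)) (yt _ e2) => z xz yz.
rewrite opprD addrACA -mulrBr (le_trans (cabsD _ _))// [e]splitr lerD// cabsM.
rewrite (le_trans (ler_wpM2l (cabs_ge0 a) xz))// mulrCA ger_pMr ?divr_gt0//.
by rewrite ler_pdivrMr// mul1r lerDl.
Qed.

Lemma ccvg_sum (T : Type) (F : set_system T) (FF : Filter F) (K : Type)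
    (r : seq K) (x : K -> T -> R[i]) (s : K -> R[i]) :
  (forall k, x k @ F --> (s k : R[i]^o)) ->
  (fun z => \sum_(k <- r) x k z) @ F --> (\sum_(k <- r) s k : R[i]^o).
Proof.
move=> xs; elim: r => [|k r IH].
  apply/cvg_cabsP => e e0; apply: nearW => z.
  by rewrite !big_nil subrr cabs0 ltW.
rewrite big_cons (_ : (fun _ => _) =
    fun z => 1 * x k z + \sum_(j <- r) x j z); last first.
  by apply/funext => z; rewrite big_cons mul1r.
have := ccvg_lin FF (a := 1) (xs k) IH.
by rewrite (_ : 1 * s k = s k)// mul1r.
Qed.

Context {I : choiceType}.
Implicit Types J : {fset I}.

Lemma big_fset_diff (V : zmodType) (a : I -> V) J J' : (J `<=` J')%fset ->
  \sum_(i <- J') a i - \sum_(i <- J) a i = \sum_(i <- (J' `\` J)%fset) a i.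
Proof.
move=> /fsetIidPr JJ'; rewrite (big_fsetID _ (mem J)) /=.
rewrite [X in X + _ - _](_ : _ = \sum_(i <- J) a i); last first.
  by apply: eq_fbigl => i; rewrite !inE/= -{2}JJ' inE.
rewrite addrAC subrr add0r; apply: eq_fbigl => i.
by rewrite !inE/= andbC.
Qed.

Lemma near_totally_sub J0 : \forall J \near totally, (J0 `<=` J)%fset.
Proof. by exists J0. Qed.

Lemma ccvg_truncated (a b : I -> R[i]) J :
  (fun J' => \sum_(i <- J') (if i \in J then a i else 0) * b i) @ totally -->
    (\sum_(i <- J) a i * b i : R[i]^o).
Proof.
apply/cvg_cabsP => e e0; have := near_totally_sub J; apply: filterS => J' JJ'.
rewrite -(big_fset_incl _ JJ') => [|i _ /negbTE ->]; last by rewrite mul0r.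
rewrite (_ : \sum_(i <- J) _ = \sum_(i <- J) a i * b i).
  by rewrite subrr cabs0 ltW.
by apply: eq_big_seq => i ->.
Qed.

Lemma near_cofinal (J_ : nat -> {fset I}) J : J_ @ \oo --> totally ->
  \forall k \near \oo, (J `<=` J_ k)%fset.
Proof. by move=> J_cof; exact: (J_cof _ (near_totally_sub J)). Qed.

(** Choose J0 so that its sum nearly attains the supremum of all finite sums;
nothing beyond J0 can then add more than e. *)
Lemma summable_tail (b : I -> R) (M : R) : (forall i, 0 <= b i) ->
  (forall J, \sum_(i <- J) b i <= M) ->
  forall e, 0 < e -> exists J0, forall J J', (J0 `<=` J)%fset ->
    (J `<=` J')%fset -> \sum_(i <- (J' `\` J)%fset) b i <= e.
Proof.
move=> b0 bM e e0; pose E := [set \sum_(i <- J) b i | J in [set: {fset I}]].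
have ubE : has_ubound E by exists M => _ [J _ <-].
have supE : has_sup E.
  by split=> //; exists (\sum_(i <- fset0) b i); exists fset0.
have [_ [J0 _ <-] J0e] := sup_adherent e0 supE.
exists J0 => J J' J0J JJ'; rewrite -big_fset_diff// lerBlDr.
have sJ' : \sum_(i <- J') b i <= sup E by apply: ub_le_sup => //; exists J'.
have mJ : \sum_(i <- J0) b i <= \sum_(i <- J) b i.
  by rewrite -subr_ge0 big_fset_diff// sumr_ge0.
by rewrite (le_trans sJ')// -lerBlDl (le_trans (ltW J0e)).
Qed.

(** The real and the imaginary parts of the partial sums are Cauchy nets in R,
by the tail estimate. *)
Lemma abs_summable_cvg (a : I -> R[i]) (M : R) :
  (forall J, \sum_(i <- J) cabs (a i) <= M) ->
  exists s : R[i], (fun J => \sum_(i <- J) a i) @ totally --> (s : R[i]^o).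
Proof.
move=> aM; have tail := summable_tail (fun i => cabs_ge0 (a i)) aM.
have real_cvg (p : R[i] -> R) : (forall z w, `|p z - p w| <= cabs (z - w)) ->
    cvg ((fun J => p (\sum_(i <- J) a i)) @ totally).
  move=> pB; apply/cauchy_cvgP/cauchy_exP => e e0.
  have [J0 J0e] := tail _ (divr_gt0 e0 (@ltr0Sn R 1)).
  exists (p (\sum_(i <- J0) a i)); exists J0 => // J /= J0J.
  rewrite /ball/= distrC (le_lt_trans (pB _ _))// big_fset_diff//.
  rewrite (le_lt_trans (cabs_sum _ _))// (le_lt_trans (J0e _ _ _ J0J))//.
  by rewrite ltr_pdivrMr// ltr_pMr// ltr1n.
have /cvg_ex[/= s ss] : cvg ((fun J => Re (\sum_(i <- J) a i)) @ totally).
  apply: real_cvg => z w; rewrite (le_trans _ (ler_Re_cabs _))//.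
  by case: z w => [? ?] [].
have /cvg_ex[/= t tt] : cvg ((fun J => Im (\sum_(i <- J) a i)) @ totally).
  apply: real_cvg => z w; rewrite (le_trans _ (ler_Im_cabs _))//.
  by case: z w => [? ?] [].
exists (Complex s t); apply/cvg_cabsP => e e0; near=> J.
rewrite (le_trans (ler_cabs_ReIm _))// [e]splitr lerD//.
  rewrite (_ : Re _ = Re (\sum_(i <- J) a i) - s); last first.
    by case: (\sum_(i <- J) a i).
  by near: J; move/cvgrPdistC_le : ss; apply; rewrite divr_gt0.
rewrite (_ : Im _ = Im (\sum_(i <- J) a i) - t); last first.
  by case: (\sum_(i <- J) a i).
by near: J; move/cvgrPdistC_le : tt; apply; rewrite divr_gt0.
Unshelve. all: by end_near. Qed.

(** Limits along the directed set of finite subsets become limits of sequences,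
which is what Fatou's lemma and the measurability of limits ask for. *)
Lemma countable_cofinal : countable [set: I] ->
  exists J_ : nat -> {fset I}, J_ @ \oo --> totally.
Proof.
move=> /countable_injP[f finj].
exists (fun n => fset_set [set i | (f i < n)%N]) => A [J0 _ J0A].
exists (\max_(i <- J0) f i).+1 => // n /= nJ0; apply: J0A => /=.
apply/fsubsetP => i iJ0; rewrite in_fset_set; last first.
  apply: (@finite_preimage _ _ `I_n f) => // x y _ _.
  by apply: finj; exact: in_setT.
apply/mem_set => /=; apply: leq_ltn_trans nJ0.
exact: (@leq_bigmax_seq _ _ xpredT f).
Qed.

End unordered_sums.

(** * Measurability and nonnegative integrals *)

Section complex_measurability.
Context {d : measure_display} {T : measurableType d} {R : realType}.
Implicit Types F G : T -> R[i].

Lemma measurable_cabs F : cmeasurable F ->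
  measurable_fun [set: T] (fun x => cabs (F x)).
Proof.
move=> [mR mI]; rewrite (_ : (fun _ => _) =
    fun x => Num.sqrt (Re (F x) ^+ 2 + Im (F x) ^+ 2)); last first.
  by apply/funext => x; rewrite -cabs_sqrE sqrtr_sqr ger0_norm ?cabs_ge0.
apply: measurableT_comp.
  by apply: continuous_measurable_fun; exact: sqrt_continuous.
by apply: measurable_funD; apply: measurable_funX.
Qed.

Lemma cmeasurable_lin (a : R[i]) F G : cmeasurable F -> cmeasurable G ->
  cmeasurable (fun x => a * F x + G x).
Proof.
case: a => [p q] [mFR mFI] [mGR mGI]; split.
  rewrite (_ : (fun _ => _) =
      (fun x => p * Re (F x) - q * Im (F x) + Re (G x))); last first.
    by apply/funext => x; case: (F x) (G x) => [? ?] [].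
  apply: measurable_funD => //; apply: measurable_funB; apply: measurable_funM;
    by [exact: measurable_cst|].
rewrite (_ : (fun _ => _) =
    (fun x => p * Im (F x) + q * Re (F x) + Im (G x))); last first.
  by apply/funext => x; case: (F x) (G x) => [? ?] [].
apply: measurable_funD => //; apply: measurable_funD; apply: measurable_funM;
  by [exact: measurable_cst|].
Qed.

Lemma cmeasurableB F G : cmeasurable F -> cmeasurable G ->
  cmeasurable (fun x => F x - G x).
Proof.
move=> mF mG; have := cmeasurable_lin (-1) mG mF.
by under eq_fun do rewrite mulN1r addrC.
Qed.

Lemma cmeasurable_sum (J : Type) (s : seq J) (c : J -> R[i])
    (F_ : J -> T -> R[i]) : (forall j, cmeasurable (F_ j)) ->
  cmeasurable (fun x => \sum_(j <- s) c j * F_ j x).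
Proof.
move=> mF; elim: s => [|j s IH]; under eq_fun do rewrite (big_nil, big_cons).
  by split; exact: measurable_cst.
exact: cmeasurable_lin.
Qed.

Lemma cmeasurable_real (f : T -> R) : measurable_fun [set: T] f ->
  cmeasurable (fun x => (f x)%:C%C).
Proof. by move=> mf; split => //=; exact: measurable_cst. Qed.

Lemma cmeasurable_cvg (F_ : nat -> T -> R[i]) F :
  (forall n, cmeasurable (F_ n)) ->
  (forall x, F_ ^~ x @ \oo --> (F x : R[i]^o)) -> cmeasurable F.
Proof.
move=> mF FF; split.
  apply: (@measurable_fun_cvg _ _ _ _ (fun n x => Re (F_ n x))) => [n|x _].
    exact: (mF n).1.
  exact: (cvg_Re_Im _ (FF x)).1.
apply: (@measurable_fun_cvg _ _ _ _ (fun n x => Im (F_ n x))) => [n|x _].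
  exact: (mF n).2.
exact: (cvg_Re_Im _ (FF x)).2.
Qed.

End complex_measurability.

Section nonnegative_integrals.
Context {d : measure_display} {T : measurableType d} {R : realType}.
Variable mu : {measure set T -> \bar R}.
Local Open Scope ereal_scope.

(** A bound on the integrals passes to the pointwise limit without any
domination; this is how tails of series are integrated. *)
Lemma fatou_le (f_ : nat -> T -> R) (g : T -> R) (M : \bar R) :
  (forall n, measurable_fun [set: T] (f_ n)) ->
  (forall n x, (0 <= f_ n x)%R) -> (forall x, f_ ^~ x @ \oo --> g x) ->
  (\forall n \near \oo, \int[mu]_x (f_ n x)%:E <= M) ->
  \int[mu]_x (g x)%:E <= M.
Proof.
move=> mf f0 fg fM.
have h := @fatou _ _ _ mu _ measurableT (fun n x => (f_ n x)%:E)
  (fun n => (measurable_EFinP _ _).2 (mf n)) (fun n x _ => f0 n x).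
rewrite (_ : (fun x => (g x)%:E) =
    fun x => limn_einf (fun n => (f_ n x)%:E)); last first.
  apply/funext => x; have gx : (fun n => (f_ n x)%:E) @ \oo --> (g x)%:E.
    exact: (cvg_comp _ _ (fg x)).
  by rewrite is_cvg_limn_einfE ?(cvg_lim _ gx)//; apply/cvg_ex; exists (g x)%:E.
apply: le_trans h _; rewrite limn_einf_lim; apply: (@lime_le nat \oo).
  exact: is_cvg_einfs.
near=> n; apply: le_trans (_ : \int[mu]_x (f_ n x)%:E <= M).
  by apply: ereal_inf_lbound; exists n => /=.
by near: n.
Unshelve. all: by end_near. Qed.

Lemma le_integralT (f g : T -> \bar R) : measurable_fun [set: T] f ->
  measurable_fun [set: T] g -> (forall x, 0 <= f x) ->
  (forall x, f x <= g x) -> \int[mu]_x f x <= \int[mu]_x g x.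
Proof. by move=> mf mg f0 fg; apply: ge0_le_integral. Qed.

(** Averaging [b i] over the cell [U i] costs a factor [D^-1]; adding the
averages costs the overlap number [N]. *)
Lemma overlap_sum_le {I : choiceType} (U : I -> set T) (N : nat) (D : R)
    (J : {fset I}) (b : I -> \bar R) (P : T -> \bar R) :
  (forall i, measurable (U i)) ->
  (forall x, (\sum_(i <- J) \1_(U i) x <= N%:R :> R)%R) ->
  (0 < D)%R -> (forall i, D%:E <= mu (U i)) ->
  measurable_fun [set: T] P -> (forall x, 0 <= P x) -> (forall i, 0 <= b i) ->
  (forall i, \forall x \ae mu, U i x -> b i <= P x) ->
  \sum_(i <- J) b i <= (N%:R / D)%:E * \int[mu]_x P x.
Proof.
move=> mU UN D0 DU mP P0 b0 bP.
have mUi i : measurable_fun [set: T] (fun x => (\1_(U i) x)%:E : \bar R).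
  by apply/measurable_EFinP; exact: measurable_indic.
have mUP i : measurable_fun [set: T] (fun x => (\1_(U i) x)%:E * P x).
  exact: emeasurable_funM.
have UP0 i x : 0 <= (\1_(U i) x)%:E * P x.
  by rewrite mule_ge0// lee_fin.
have step i : b i <= D^-1%:E * \int[mu]_x ((\1_(U i) x)%:E * P x).
  rewrite lee_pdivlMl//; apply: le_trans (_ : mu (U i) * b i <= _).
    by rewrite lee_wpmul2r.
  rewrite -[X in mu X]setIT -integral_indic// -ge0_integralZr//.
  apply: ae_ge0_le_integral => //.
  - by move=> x _; rewrite mule_ge0// lee_fin.
  - by apply: emeasurable_funM => //; exact: measurable_cst.
  have := bP i; apply: filterS => x bx _; rewrite indicE.
  have [/set_mem /bx|] := boolP (x \in U i); first by rewrite !mul1e.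
  by rewrite !mul0e.
apply: le_trans (_ : \sum_(i <- J)
    (D^-1%:E * \int[mu]_x ((\1_(U i) x)%:E * P x)) <= _).
  exact: lee_sum.
rewrite -ge0_sume_distrr; last by move=> i _; apply: integral_ge0.
rewrite -ge0_integral_sum// [(N%:R / D)%R]mulrC EFinM -muleA.
rewrite lee_wpmul2l ?lee_fin ?invr_ge0 ?(ltW D0)//.
rewrite -ge0_integralZl//.
apply: le_integralT => //.
- exact: emeasurable_sum.
- by apply: emeasurable_funM => //; exact: measurable_cst.
- by move=> x; apply: sume_ge0.
move=> x; rewrite -ge0_sume_distrl; last by move=> i _; rewrite lee_fin.
by rewrite lee_wpmul2r// sumEFin lee_fin.
Qed.

End nonnegative_integrals.

Section tonelli.
Context {d : measure_display} {T : measurableType d} {R : realType}.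
Variable mu : {measure set T -> \bar R}.
Hypothesis mu_sf : sigma_finite [set: T] mu.
Local Open Scope ereal_scope.

(** A copy of [mu] on which the sigma-finite structure can be declared. *)
Let smu : set T -> \bar R := mu.
HB.instance Definition _ := Measure.on smu.
HB.instance Definition _ := Measure_isSigmaFinite.Build _ _ _ smu mu_sf.

Lemma sigma_finite_tonelli (f : T * T -> \bar R) :
  measurable_fun [set: T * T] f -> (forall p, 0 <= f p) ->
  \int[mu]_x \int[mu]_y f (x, y) = \int[mu]_y \int[mu]_x f (x, y).
Proof. by move=> mf f0; exact: (@fubini_tonelli _ _ _ _ _ smu smu f mf f0). Qed.

Lemma measurable_partial_integral (f : T * T -> \bar R) :
  measurable_fun [set: T * T] f -> (forall p, 0 <= f p) ->
  measurable_fun [set: T] (fun x => \int[mu]_y f (x, y)).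
Proof.
by move=> mf f0; exact: (@measurable_fun_fubini_tonelli_F _ _ _ _ _ smu f mf f0).
Qed.

End tonelli.

(** * Radon measures and admissible coverings *)

Section topology.
Context {X : ptopologicalType} {R : realType}.
Variable mu : {measure set (borel X) -> \bar R}.

Lemma closed_borel (A : set X) : closed A -> measurable (A : set (borel X)).
Proof.
move=> cA; rewrite -[A]setCK; apply: measurableC.
by apply: sub_sigma_algebra; exact: closed_openC.
Qed.

Lemma radon_sigma_finite : hausdorff_space X -> sigma_compact X ->
  radon_measure mu -> sigma_finite [set: borel X] mu.
Proof.
move=> hX [K [cK KX]] [muK _ _]; exists K => // n.
split; last exact: muK.
by apply: closed_borel; exact: compact_closed.
Qed.

Context {I : choiceType}.
Variable U : I -> set X.
Hypothesis U_adm : admissible_covering U.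

Lemma admissible_measurable i : measurable (U i : set (borel X)).
Proof. by case: U_adm => _ _ /(_ i)[]. Qed.

Lemma admissible_measure_fin i : radon_measure mu -> (mu (U i) < +oo)%E.
Proof.
have [_ _ /(_ i)[mU pU _] _] := U_adm => -[muK _ _].
have cU : compact (closure (U i)) by rewrite -precompactE.
apply: le_lt_trans (muK _ cU); apply: le_measure; first exact/mem_set.
  by apply/mem_set; apply: closed_borel; exact: closed_closure.
exact: subset_closure.
Qed.

(** All cells that contain [x] meet any single one of them. *)
Lemma admissible_overlap : exists N : nat, forall (J : {fset I}) (x : X),
  \sum_(i <- J) \1_(U i) x <= N%:R :> R.
Proof.
have [UX _ _ [N UN]] := U_adm; exists N => J x.
have [i0 _ Ui0x] : (\bigcup_i U i) x by rewrite UX.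
have := UN i0; set S := [set j | _] => SN.
have finS : finite_set S by apply/finite_set_leP; exists N.
apply: le_trans (_ : \sum_(i <- fset_set S) (1 : R) <= _); last first.
  rewrite big_const_seq count_predT iter_addr_0 ler_nat.
  exact: geq_card_fset_set SN.
apply: le_trans (_ : \sum_(i <- (J `&` fset_set S)%fset) (1 : R) <= _).
  rewrite (big_fsetID _ (fun i => i \in fset_set S)) /=.
  rewrite [X in _ + X]big1_fset ?addr0; last first.
    move=> i; rewrite !inE/= => /andP[_ /negP iS] _.
    rewrite indicE; case: (boolP (x \in U i)) => // /set_mem Uix.
    by case: iS; rewrite in_fset_set//; apply/mem_set; exists x.
  rewrite [X in X <= _](_ : _ =
      \sum_(i <- (J `&` fset_set S)%fset) \1_(U i) x :> R).
    by apply: ler_sum => i _; rewrite indicE; case: (_ \in _).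
  by apply: eq_fbigl => i; rewrite !inE.
rewrite -[X in X <= _]addr0 -lerBrDl; have IS := fsubsetIr J (fset_set S).
by rewrite (big_fset_diff (fun=> 1 : R) IS) sumr_ge0.
Qed.

(** By local finiteness a compact set meets finitely many cells, and each cell,
having interior points, meets some member of a compact exhaustion. *)
Lemma admissible_countable : sigma_compact X -> countable [set: I].
Proof.
have [UX lf Ui _] := U_adm => -[K [cK KX]].
have IK : [set: I] = \bigcup_n [set i | U i `&` K n !=set0].
  apply/seteqP; split=> // i _; have [_ _ [x /interior_subset Uix]] := Ui i.
  by have [n _ Knx] : (\bigcup_n K n) x by [rewrite KX]; exists n => //; exists x.
rewrite IK; apply: bigcup_countable => // n _; apply: finite_set_countable.
have /compact_near_coveringP/(_ _ totally
  (fun (J : {fset I}) x => forall i, U i x -> i \in J)) := cK n.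
case=> [x _|J _ /= KJ].
  have [V Vx Vfin] := lf x.
  exists (V, [set J | (fset_set [set i | U i `&` V !=set0] `<=` J)%fset]).
    by split => //=; exact: near_totally_sub.
  move=> [y J]/= [Vy /fsubsetP SJ] i Uiy; apply: SJ.
  by rewrite in_fset_set//; apply/mem_set; exists y.
apply: (@sub_finite_set _ _ [set` J]); last exact: finite_fset.
by move=> i [x [Uix Kx]] /=; apply: (KJ _ (fsubset_refl _) x Kx).
Qed.

End topology.

(** * Inner product and real-valued norm *)

Section inner_product.
Context {R : realType} {H : completeNormedModType R[i]}.
Variable dot : {dot H for (fun z : R[i] => z^*)}.
Hypothesis dot_norm : forall f, dot f f = `|f| ^+ 2.

(** The norm of a module over R[i] takes values in R[i]. *)
Definition rnorm (u : H) : R := Re `|u|.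

Lemma normE u : `|u| = (rnorm u)%:C%C.
Proof. by rewrite /rnorm RRe_real// ger0_real. Qed.

Lemma rnorm_ge0 u : 0 <= rnorm u.
Proof. by rewrite -ler0c -normE. Qed.

Lemma rnorm_eq0 u : rnorm u = 0 -> u = 0.
Proof. by move=> u0; apply/eqP; rewrite -normr_eq0 normE u0. Qed.

Lemma rnormZ (a : R[i]) u : rnorm (a *: u) = cabs a * rnorm u.
Proof.
by apply: complexI; rewrite -normE normrZ normE rmorphM.
Qed.

Lemma dotDl u v w : dot (u + v) w = dot u w + dot v w.
Proof. exact: linearDl. Qed.

Lemma dotBl u v w : dot (u - v) w = dot u w - dot v w.
Proof. exact: linearBl. Qed.

Lemma dotZl (a : R[i]) u w : dot (a *: u) w = a * dot u w.
Proof. exact: linearZl_LR. Qed.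

Lemma dot_conj u v : dot u v = (dot v u)^*.
Proof. by rewrite [LHS](@hermC R[i] false Num.conj)/= expr0 mul1r. Qed.

Lemma dotDr u v w : dot u (v + w) = dot u v + dot u w.
Proof. exact: linearDr. Qed.

Lemma dotBr u v w : dot u (v - w) = dot u v - dot u w.
Proof. exact: linearBr. Qed.

Lemma dotZr (a : R[i]) u w : dot u (a *: w) = a^* * dot u w.
Proof. exact: linearZr_LR. Qed.

Lemma dot_suml (J : Type) (s : seq J) (u : J -> H) w :
  dot (\sum_(j <- s) u j) w = \sum_(j <- s) dot (u j) w.
Proof. exact: linear_sumlz. Qed.

Lemma cabs_dotC u v : cabs (dot u v) = cabs (dot v u).
Proof. by rewrite dot_conj cabs_conj. Qed.

(** Rotating one argument turns statements on the real part of an inner product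
into statements on its modulus. *)
Lemma dot_phase u v : exists2 c : R[i], cabs c = 1 &
  dot (c *: u) v = (cabs (dot u v))%:C%C.
Proof.
have [d0|d0] := eqVneq (dot u v) 0.
  exists 1; first exact: Normc.normc1.
  by rewrite scale1r d0 cabs0.
have c0 : cabs (dot u v) != 0.
  by apply: contraNneq d0 => /Normc.eq0_normc ->.
exists ((dot u v)^* / (cabs (dot u v))%:C%C).
  by rewrite cabsM Normc.normcV cabs_conj cabs_real ger0_norm ?cabs_ge0// divff.
have cC0 : (cabs (dot u v))%:C%C != 0 :> R[i].
  by apply: contraNneq c0 => /complexI ->.
rewrite dotZl mulrAC [_^* * _]mulrC -normCK expr2 -mulrA.
by rewrite (_ : `|dot u v| = (cabs (dot u v))%:C%C)// divff ?mulr1.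
Qed.

Lemma rnorm_sqrDB u v : Im (dot u v) = 0 ->
  rnorm (u + v) ^+ 2 = rnorm (u - v) ^+ 2 + 4%:R * Re (dot u v).
Proof.
move=> I0; have vu : dot v u = dot u v.
  rewrite dot_conj; case: (dot u v) I0 => a b /= ->.
  by congr Complex; exact: oppr0.
apply: complexI; rewrite rmorphD/= !rmorphXn/= rmorphM/= -!normE.
rewrite -!dot_norm !dotBl !dotBr !dotDl !dotDr vu.
rewrite (_ : (Re (dot u v))%:C%C = dot u v); last first.
  by case: (dot u v) I0 => a b /= ->.
rewrite rmorph_nat; ring.
Qed.

Lemma dot0l u : dot 0 u = 0.
Proof. exact: linear0l. Qed.

Lemma rnorm_sqrD u v : rnorm (u + v) ^+ 2 + rnorm (u - v) ^+ 2 =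
  2%:R * (rnorm u ^+ 2 + rnorm v ^+ 2).
Proof.
have : `|u + v| ^+ 2 + `|u - v| ^+ 2 = 2%:R * (`|u| ^+ 2 + `|v| ^+ 2).
  by rewrite -!dot_norm !dotBl !dotBr !dotDl !dotDr; ring.
rewrite !normE -[2%:R in RHS](rmorph_nat (real_complex R)).
by rewrite -!(rmorphXn, rmorphD, rmorphM) => /complexI.
Qed.

(** Once [u] is rotated and scaled to the norm of [v], the inequality says that
the square of the norm of the difference is nonnegative. *)
Lemma cauchy_schwarz u v : cabs (dot u v) <= rnorm u * rnorm v.
Proof.
have [->|u0] := eqVneq u 0.
  by rewrite dot0l cabs0 mulr_ge0 ?rnorm_ge0.
have [->|v0] := eqVneq v 0.
  by rewrite cabs_dotC dot0l cabs0 mulr_ge0 ?rnorm_ge0.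
have pos w : w != 0 -> 0 < rnorm w.
  move=> w0; rewrite lt_neqAle rnorm_ge0 andbT eq_sym.
  by apply: contraNneq w0 => /rnorm_eq0 ->.
have [c c1 cuv] := dot_phase u v.
set t := rnorm v / rnorm u; set w := (t%:C%C * c) *: u.
have t0 : 0 < t by rewrite divr_gt0 ?pos.
have wv : dot w v = (t * cabs (dot u v))%:C%C.
  by rewrite /w -scalerA dotZl cuv -rmorphM.
have rw : rnorm w = rnorm v.
  rewrite rnormZ cabsM c1 mulr1 cabs_real ger0_norm ?(ltW t0)// divfK//.
  by rewrite gt_eqF// pos.
have := rnorm_sqrDB (u := w) (v := v); rewrite wv => /(_ erefl) /= h1.
have h2 := rnorm_sqrD w v; have h3 := sqr_ge0 (rnorm (w - v)).
rewrite rw in h2; have h : t * cabs (dot u v) <= rnorm v ^+ 2 by lra.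
rewrite -(ler_pM2l t0) (le_trans h)// mulrA.
by rewrite /t divfK ?expr2// gt_eqF// pos.
Qed.

End inner_product.

(** * Voice transform, the space H_1^nu and its antidual *)

Section voice_transform.
Context {X : ptopologicalType} {R : realType}.
Variable mu : {measure set (borel X) -> \bar R}.
Context {H : completeNormedModType R[i]}.
Variable dot : {dot H for (fun z : R[i] => z^*)}.
Variables (phi : borel X -> H) (nu : borel X -> R).
Hypothesis dot_norm : forall f, dot f f = `|f| ^+ 2.
Hypothesis phi_parseval : parseval_frame mu dot phi.
Hypothesis nu_weight : weight nu.

Local Notation aV h y := (cabs (dot h (phi y))).

Lemma voice_cmeasurable h : cmeasurable (voice phi (dot h)).
Proof. by have [] := phi_parseval h. Qed.

Lemma voice_abs_measurable h : measurable_fun [set: borel X] (fun y => aV h y).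
Proof. exact: measurable_cabs (voice_cmeasurable h). Qed.

Lemma weight_gt0 y : 0 < nu y.
Proof. by apply: lt_le_trans (nu_weight.2 y). Qed.

Lemma weight_ge0 y : 0 <= nu y.
Proof. exact: ltW (weight_gt0 y). Qed.

(** The norm of H_1^nu as an extended real, so that it makes sense for every
element of H and membership in H_1^nu is its finiteness. *)
Definition H1enorm (h : H) : \bar R := (\int[mu]_y (aV h y * nu y)%:E)%E.

Lemma H1enorm_ge0 h : (0 <= H1enorm h)%E.
Proof.
apply: integral_ge0 => y _.
by rewrite lee_fin mulr_ge0 ?cabs_ge0 ?weight_ge0.
Qed.

Lemma H1enormE h : wLnorm mu 1 nu (voice phi (dot h)) = H1enorm h.
Proof.
rewrite /wLnorm Lnorm1; apply: eq_integral => y _.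
by rewrite gee0_abs// lee_fin mulr_ge0 ?cabs_ge0 ?weight_ge0.
Qed.

Lemma H1E h : H1 mu dot phi nu h <-> (H1enorm h < +oo)%E.
Proof. by rewrite /H1/= H1enormE. Qed.

Lemma H1normE h : H1 mu dot phi nu h -> (H1norm mu dot phi nu h)%:E = H1enorm h.
Proof.
by move=> /H1E h1; rewrite /H1norm H1enormE fineK// ge0_fin_numE ?H1enorm_ge0.
Qed.

Lemma measurable_voice_weight h :
  measurable_fun [set: borel X] (fun y => (aV h y * nu y)%:E).
Proof.
apply/measurable_EFinP/measurable_funM; first exact: voice_abs_measurable.
exact: nu_weight.1.
Qed.

Lemma measurable_voice_mul u h :
  measurable_fun [set: borel X] (fun y => (aV u y * aV h y)%:E).
Proof.
by apply/measurable_EFinP/measurable_funM; exact: voice_abs_measurable.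
Qed.

(** This is polarization of the Parseval identity. Bounding the integrand of the
square of [w + h] by that of [w - h] plus a multiple of the product, instead of
integrating a difference, keeps all integrals nonnegative. *)
Lemma dot_le_voice u h :
  ((cabs (dot u h))%:E <= \int[mu]_y (aV u y * aV h y)%:E)%E.
Proof.
have [c c1 cuh] := dot_phase dot u h; set w := c *: u.
have -> : (\int[mu]_y (aV u y * aV h y)%:E = \int[mu]_y (aV w y * aV h y)%:E)%E.
  by apply: eq_integral => y _; rewrite /w dotZl cabsM c1 mul1r.
have E f : (\int[mu]_x ((aV f x) ^+ 2)%:E = (rnorm f ^+ 2)%:E)%E.
  by have [] := phi_parseval f.
have mE f : measurable_fun [set: borel X] (fun x => ((aV f x) ^+ 2)%:E).
  by apply/measurable_EFinP/measurable_funX; exact: voice_abs_measurable.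
have m4 : measurable_fun [set: borel X] (fun x => (4%:R * (aV w x * aV h x))%:E).
  apply/measurable_EFinP/measurable_funM; first exact: measurable_cst.
  by apply: measurable_funM; exact: voice_abs_measurable.
have p4 x : (0 <= (4%:R * (aV w x * aV h x))%:E)%E.
  by rewrite lee_fin mulr_ge0// mulr_ge0 ?cabs_ge0.
have pE f x : (0 <= ((aV f x) ^+ 2)%:E)%E by rewrite lee_fin sqr_ge0.
have := rnorm_sqrDB dot_norm (u := w) (v := h); rewrite cuh => /(_ erefl)/= h1.
have : (\int[mu]_x ((aV (w + h) x) ^+ 2)%:E <=
    \int[mu]_x ((aV (w - h) x) ^+ 2)%:E +
    \int[mu]_x (4%:R * (aV w x * aV h x))%:E)%E.
  rewrite -ge0_integralD//; apply: le_integralT => //; first exact: emeasurable_funD.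
  move=> x; rewrite -EFinD lee_fin dotDl dotBl; exact: cabs_sqrD_le.
rewrite !E h1 EFinD leeD2lE//.
under [X in (_ <= X)%E]eq_integral do rewrite EFinM.
rewrite ge0_integralZl//; last 2 first.
- exact: measurable_voice_mul.
- by move=> x _; rewrite lee_fin mulr_ge0 ?cabs_ge0.
by rewrite EFinM lee_pmul2l.
Qed.

(** The weight is arbitrary because the estimate serves both the norm of H_1^nu,
with [w = nu], and the pairing with a fixed [h], with [w] the modulus of its
voice transform. *)
Lemma int_voice_sum (w : borel X -> R) (J : Type) (s : seq J) (c : J -> R[i])
    (u : J -> H) :
  measurable_fun [set: borel X] w -> (forall y, 0 <= w y) ->
  (\int[mu]_y (aV (\sum_(j <- s) c j *: u j)%R y * w y)%:E <=
   \sum_(j <- s) (cabs (c j))%:E * \int[mu]_y (aV (u j) y * w y)%:E)%E.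
Proof.
move=> mw w0.
have p j x : (0 <= (cabs (c j) * (aV (u j) x * w x))%:E)%E.
  by rewrite lee_fin !mulr_ge0 ?cabs_ge0.
have mVw v : measurable_fun [set: borel X] (fun y => (aV v y * w y)%:E).
  by apply/measurable_EFinP/measurable_funM => //; exact: voice_abs_measurable.
have m j : measurable_fun [set: borel X]
    (fun x => (cabs (c j) * (aV (u j) x * w x))%:E).
  apply/measurable_EFinP/measurable_funM; first exact: measurable_cst.
  by apply/measurable_EFinP; exact: mVw.
rewrite (_ : (\sum_(j <- s) _)%E =
    (\int[mu]_x (\sum_(j <- s) (cabs (c j) * (aV (u j) x * w x))%:E))%E).
  apply: le_integralT => //.
  - exact: emeasurable_sum.
  - by move=> x; rewrite lee_fin mulr_ge0 ?cabs_ge0.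
  move=> x; rewrite sumEFin lee_fin.
  under [leRHS]eq_bigr do rewrite mulrA -cabsM -dotZl.
  rewrite -mulr_suml ler_wpM2r// dot_suml.
  exact: cabs_sum.
rewrite ge0_integral_sum//; apply: eq_bigr => j _.
under [RHS]eq_integral do rewrite EFinM.
rewrite ge0_integralZl//.
- by move=> x _; rewrite lee_fin mulr_ge0 ?cabs_ge0.
- by rewrite lee_fin cabs_ge0.
Qed.

Lemma H1enorm_sum (J : Type) (s : seq J) (c : J -> R[i]) (u : J -> H) :
  (H1enorm (\sum_(j <- s) c j *: u j)%R <=
   \sum_(j <- s) (cabs (c j))%:E * H1enorm (u j))%E.
Proof.
apply: int_voice_sum; first exact: nu_weight.1.
by move=> y; exact: weight_ge0.
Qed.

Local Notation H1 := (H1 mu dot phi nu).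

Lemma H1_sum (J : Type) (s : seq J) (c : J -> R[i]) (u : J -> H) :
  (forall j, H1 (u j)) -> H1 (\sum_(j <- s) c j *: u j).
Proof.
move=> uH; apply/H1E; apply: le_lt_trans (H1enorm_sum _ _ _) _.
elim/big_ind : _ => // [|j _]; first by move=> *; exact: lte_add_pinfty.
have /H1E := uH j; have := H1enorm_ge0 (u j); case: (H1enorm (u j)) => // r _ _.
by rewrite -EFinM ltry.
Qed.

Lemma H1D u v : H1 u -> H1 v -> H1 (u + v).
Proof.
move=> uH vH; have := @H1_sum bool [:: true; false] (fun=> 1)
  (fun b => if b then u else v).
by rewrite !big_cons big_nil !scale1r addr0; apply; case.
Qed.

Lemma H1Z a u : H1 u -> H1 (a *: u).
Proof.
move=> uH; have := @H1_sum unit [:: tt] (fun=> a) (fun=> u).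
by rewrite big_cons big_nil addr0; apply.
Qed.

Lemma H1B u v : H1 u -> H1 v -> H1 (u - v).
Proof. by move=> uH vH; rewrite -scaleN1r; apply: H1D => //; exact: H1Z. Qed.

Lemma H1_0 : H1 0.
Proof.
by have := @H1_sum void [::] (fun=> 0) (fun=> 0); rewrite big_nil; apply; case.
Qed.

Local Notation antidual := (antidual mu dot phi nu).

Lemma antidual0 f : antidual f -> f 0 = 0.
Proof.
move=> [fl _]; have := fl 1 0 0 H1_0 H1_0; rewrite scaler0 addr0 rmorph1 mul1r.
by move/eqP; rewrite -subr_eq0 opprD addrA subrr sub0r oppr_eq0 => /eqP.
Qed.

Lemma antidual_sum f (J : Type) (s : seq J) (c : J -> R[i]) (u : J -> H) :
  antidual f -> (forall j, H1 (u j)) ->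
  f (\sum_(j <- s) c j *: u j) = \sum_(j <- s) (c j)^* * f (u j).
Proof.
move=> fA uH; elim: s => [|j s IH]; first by rewrite !big_nil antidual0.
by rewrite !big_cons fA.1//; [rewrite IH|exact: H1_sum].
Qed.

Lemma antidualB f u v : antidual f -> H1 u -> H1 v -> f (u - v) = f u - f v.
Proof.
move=> fA uH vH; rewrite addrC -scaleN1r fA.1// rmorphN rmorph1 mulN1r.
by rewrite addrC.
Qed.

Lemma antidual_bound f : antidual f -> exists2 C : R, 0 <= C &
  forall u, H1 u -> ((cabs (f u))%:E <= C%:E * H1enorm u)%E.
Proof.
move=> [_ [C fC]]; exists `|C| => // u uH.
rewrite -H1normE// -EFinM lee_fin (le_trans (fC u uH))//.
rewrite ler_wpM2r ?ler_norm// -lee_fin H1normE//; exact: H1enorm_ge0.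
Qed.

Variable CB : R.
Hypothesis CB_gt0 : 0 < CB.
Hypothesis phi_bound : forall x, `|phi x| <= (CB * nu x)%:C%C.

Lemma int_voice_le_H1enorm u h :
  (\int[mu]_y (aV u y * aV h y)%:E <= (rnorm u * CB)%:E * H1enorm h)%E.
Proof.
rewrite /H1enorm -ge0_integralZl//.
- apply: le_integralT; first exact: measurable_voice_mul.
  + apply: emeasurable_funM; first exact: measurable_cst.
    exact: measurable_voice_weight.
  + by move=> x; rewrite lee_fin mulr_ge0 ?cabs_ge0.
  + move=> x; rewrite -EFinM lee_fin [leRHS]mulrCA [leRHS]mulrC.
    rewrite ler_wpM2r ?cabs_ge0//.
    rewrite (le_trans (cauchy_schwarz dot_norm _ _))// -mulrA.
    rewrite ler_wpM2l ?rnorm_ge0//.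
    by rewrite -lecR -normE phi_bound.
- exact: measurable_voice_weight.
- by move=> x _; rewrite lee_fin mulr_ge0 ?cabs_ge0 ?weight_ge0.
- by rewrite lee_fin mulr_ge0 ?rnorm_ge0 ?ltW.
Qed.

(** This is the continuity of the embeddings of H_1^nu into H and of H into the
antidual. *)
Lemma dot_le_H1enorm u h :
  ((cabs (dot u h))%:E <= (rnorm u * CB)%:E * H1enorm h)%E.
Proof. exact: le_trans (dot_le_voice u h) (int_voice_le_H1enorm u h). Qed.

Lemma dot_antidual u : antidual (dot u).
Proof.
split=> [a v w _ _|]; first by rewrite dotDr dotZr.
exists (rnorm u * CB) => h hH; have := dot_le_H1enorm u h.
by rewrite -H1normE// -EFinM lee_fin.
Qed.

End voice_transform.

(** * Kernels of the weighted algebra and sampled atoms *)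

Section weighted_kernels.
Context {X : ptopologicalType} {R : realType}.
Variable mu : {measure set (borel X) -> \bar R}.
Variable nu : borel X -> R.
Hypothesis nu_weight : weight nu.
Variable K : borel X -> borel X -> \bar R.
Hypothesis K_ge0 : forall x y, (0 <= K x y)%E.
Hypothesis mK : measurable_fun [set: borel X * borel X]
  (fun p : borel X * borel X => K p.1 p.2).
Hypothesis K_fin : (Amnorm mu nu K < +oo)%E.
Local Open Scope ereal_scope.

Let nu_gt0 := weight_gt0 nu_weight.

Lemma le_m_weight x y : (nu y <= m_weight nu x y * nu x)%R.
Proof.
by rewrite -ler_pdivrMr// /m_weight le_max lexx orbT.
Qed.

Lemma measurable_kernel_row x : measurable_fun [set: borel X] (K x).
Proof. exact: (measurableT_comp mK (measurable_pair1 x)). Qed.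

Lemma measurable_m_weight x : measurable_fun [set: borel X] (m_weight nu x).
Proof.
have mnu := nu_weight.1.
apply: measurable_maxr; apply: measurable_funM => //.
rewrite (_ : (fun y => (nu y)^-1) = (@powR R ^~ (-1)) \o nu)%R; last first.
  by apply/funext => y; rewrite /= powR_inv1// ltW.
by apply: measurableT_comp => //; exact: measurable_powR.
Qed.

(** Since [nu y <= m_weight nu x y * nu x], the weighted row integral of [K] is
a Schur bound for the action of [K] on [nu]. *)
Lemma kernel_weight_bound : exists2 A : R, (0 <= A)%R &
  \forall x \ae mu, \int[mu]_y (K x y * (nu y)%:E) <= (A * nu x)%:E.
Proof.
have [A A0 KA] : exists2 A : R, (0 <= A)%R & Amnorm mu nu K <= A%:E.
  move: K_fin; case: (Amnorm mu nu K) => [r _||_]//.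
    by exists `|r|%R => //; rewrite lee_fin ler_norm.
  by exists 0%R => //; exact: leNye.
exists A => //.
have := ess_sup_ge mu (fun x => \int[mu]_y `|K x y * (m_weight nu x y)%:E|).
apply: filterS => x Kx.
have {Kx} : \int[mu]_y `|K x y * (m_weight nu x y)%:E| <= A%:E.
  apply: le_trans Kx _; apply: le_trans KA; rewrite /Amnorm /A1norm le_max.
  by apply/orP; left; exact: lexx.
have m0 y : (0 <= (m_weight nu x y)%:E)%E.
  by rewrite lee_fin -(pmulr_lge0 _ (nu_gt0 x)) (le_trans _ (le_m_weight x y))// ltW.
under eq_integral do rewrite gee0_abs ?mule_ge0//.
move=> Kx; rewrite EFinM; apply: le_trans (_ : \int[mu]_y
    (K x y * (m_weight nu x y)%:E * (nu x)%:E) <= _).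
  apply: le_integralT.
  - apply: emeasurable_funM; first exact: measurable_kernel_row.
    by apply/measurable_EFinP; exact: nu_weight.1.
  - apply: emeasurable_funM; last exact: measurable_cst.
    apply: emeasurable_funM; first exact: measurable_kernel_row.
    by apply/measurable_EFinP; exact: measurable_m_weight.
  - by move=> y; rewrite mule_ge0// lee_fin ltW.
  - move=> y; rewrite -muleA lee_wpmul2l// -EFinM lee_fin; exact: le_m_weight.
rewrite ge0_integralZr//.
- by rewrite lee_wpmul2r// lee_fin ltW.
- apply: emeasurable_funM; first exact: measurable_kernel_row.
  by apply/measurable_EFinP; exact: measurable_m_weight.
- by move=> y _; rewrite mule_ge0.
- by rewrite lee_fin ltW.
Qed.

(** A finite row integral forces finite values almost everywhere. *)
Lemma kernel_ae_fin : \forall x \ae mu, \forall y \ae mu, K x y \is a fin_num.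
Proof.
have [A _ KA] := kernel_weight_bound.
move: KA; apply: filterS => x KA.
have mf : measurable_fun [set: borel X] (fun y => K x y * (nu y)%:E).
  apply: emeasurable_funM; first exact: measurable_kernel_row.
  by apply/measurable_EFinP; exact: nu_weight.1.
have : mu.-integrable [set: borel X] (fun y => K x y * (nu y)%:E).
  apply/integrableP; split => //; apply: le_lt_trans (ltry (A * nu x)%R).
  apply: le_trans KA; apply: le_integralT => //.
  - exact: measurableT_comp.
  - by move=> y; rewrite gee0_abs// mule_ge0// lee_fin ltW.
move=> /(integrable_ae measurableT); apply: filterS => y /(_ Logic.I).
rewrite !ge0_fin_numE//; last by rewrite mule_ge0// lee_fin ltW.
have := K_ge0 x y; case: (K x y) => // [r _ _|_]; first exact: ltry.
by rewrite gt0_mulye// lte_fin.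
Qed.

End weighted_kernels.

Section atoms.
Context {X : ptopologicalType} {R : realType}.
Variable mu : {measure set (borel X) -> \bar R}.
Context {H : completeNormedModType R[i]}.
Variable dot : {dot H for (fun z : R[i] => z^*)}.
Variables (phi : borel X -> H) (nu : borel X -> R).
Hypothesis mu_sf : sigma_finite [set: borel X] mu.
Hypothesis phi_parseval : parseval_frame mu dot phi.
Hypothesis nu_weight : weight nu.
Context {I : choiceType}.
Variables (U : I -> set (borel X)) (N : nat) (D : R).
Hypothesis mU : forall i, measurable (U i).
Hypothesis UN : forall (J : {fset I}) x, \sum_(i <- J) \1_(U i) x <= N%:R :> R.
Hypothesis D_gt0 : 0 < D.
Hypothesis DU : forall i, (D%:E <= mu (U i))%E.

Local Notation aV h y := (cabs (dot h (phi y))).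
Local Notation H1enorm := (H1enorm mu dot phi nu).

Let nu_gt0 := weight_gt0 nu_weight.

Section dual_atoms.
Variables (q : I -> H) (Kt : borel X -> borel X -> \bar R).
Hypothesis Kt_ge0 : forall x y, (0 <= Kt x y)%E.
Hypothesis mKt : measurable_fun [set: borel X * borel X]
  (fun p : borel X * borel X => Kt p.1 p.2).
Hypothesis Kt_fin : (Amnorm mu nu Kt < +oo)%E.
Hypothesis q_le : forall i x y, U i x -> ((aV (q i) y)%:E <= Kt x y)%E.

(** The voice transform of an atom is dominated by the row of the kernel at any
point of its cell; integrate that row against [nu]. *)
Lemma H1enorm_dual_atom : exists2 A : R, 0 <= A &
  forall i, \forall x \ae mu, U i x -> (H1enorm (q i) <= (A * nu x)%:E)%E.
Proof.
have [A A0 KA] := kernel_weight_bound nu_weight Kt_ge0 mKt Kt_fin.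
exists A => // i; move: KA; apply: filterS => x KA Uix; apply: le_trans KA.
apply: le_integralT.
- exact: measurable_voice_weight.
- apply: emeasurable_funM; first exact: measurable_kernel_row.
  by apply/measurable_EFinP; exact: nu_weight.1.
- by move=> y; rewrite lee_fin mulr_ge0 ?cabs_ge0 ?ltW.
- by move=> y; rewrite EFinM lee_wpmul2r ?q_le// lee_fin ltW.
Qed.

(** The cell has positive measure, so that the almost everywhere bound for its
atom holds at one of its points. *)
Lemma H1_dual_atom i : H1 mu dot phi nu (q i).
Proof.
apply/H1E => //; have [A _ /(_ i) qA] := H1enorm_dual_atom.
rewrite ltNge; apply/negP => Ny.
have : mu (U i) = 0%E.
  apply/(negligibleP mu (mU i)); move: qA => [Z [mZ Z0 /= HZ]].
  exists Z; split => // x Uix; apply: HZ => /= /(_ Uix).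
  by move/(le_trans Ny); rewrite leye_eq.
by move=> U0; have := DU i; rewrite U0 lee_fin leNgt D_gt0.
Qed.

End dual_atoms.

Section frame_atoms.
Variables (p : I -> H) (K : borel X -> borel X -> \bar R).
Hypothesis K_ge0 : forall x y, (0 <= K x y)%E.
Hypothesis mK : measurable_fun [set: borel X * borel X]
  (fun p : borel X * borel X => K p.1 p.2).
Hypothesis K_fin : (Amnorm mu nu K < +oo)%E.
Hypothesis p_le : forall i x y, U i x -> ((aV (p i) y)%:E <= K y x)%E.

Variables (q : I -> H) (A : R).
Hypothesis A_ge0 : 0 <= A.
Hypothesis qA : forall i, \forall x \ae mu, U i x ->
  (H1enorm (q i) <= (A * nu x)%:E)%E.

(** Absolute convergence in H_1^nu of the dual series sum <h,p_i> q_i. For almost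
every [x] in the cell [U i], the [i]-th summand is at most
[A * nu x] times the integral of the modulus of the voice transform of [h]
against [K ^~ x]; the overlap estimate turns the sum into an iterated integral,
and integrating over [x] first brings in the Schur bound for [K]. *)
Lemma atoms_sum_bound : exists2 C : R, 0 <= C & forall (J : {fset I}) h,
  (\sum_(i <- J) H1enorm (q i) * \int[mu]_y (aV h y * aV (p i) y)%:E
     <= C%:E * H1enorm h)%E.
Proof.
have [B B0 KB] := kernel_weight_bound nu_weight K_ge0 mK K_fin.
exists (N%:R / D * (A * B)).
  by rewrite mulr_ge0 ?divr_ge0 ?(ltW D_gt0)// mulr_ge0.
move=> J h.
pose f (z : borel X * borel X) : \bar R :=
  ((A * nu z.1)%:E * ((aV h z.2)%:E * K z.2 z.1))%E.
have f0 z : (0 <= f z)%E.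
  apply: mule_ge0; first by rewrite lee_fin mulr_ge0// ltW.
  by rewrite mule_ge0// lee_fin cabs_ge0.
have mf : measurable_fun [set: borel X * borel X] f.
  apply: emeasurable_funM.
    apply/measurable_EFinP/measurable_funM; first exact: measurable_cst.
    exact: measurableT_comp nu_weight.1 measurable_fst.
  apply: emeasurable_funM.
    apply/measurable_EFinP.
    apply: (measurableT_comp (voice_abs_measurable phi_parseval h) (g := snd)).
    exact: measurable_snd.
  apply: (measurableT_comp mK (g := fun z => (z.2, z.1))).
  exact: measurable_fun_pair.
have mKy x : measurable_fun [set: borel X] (K^~ x).
  exact: (measurableT_comp mK (measurable_pair2 x)).
have mV : measurable_fun [set: borel X] (fun y => (aV h y)%:E).
  by apply/measurable_EFinP; exact: voice_abs_measurable.
have mVK x : measurable_fun [set: borel X] (fun y => ((aV h y)%:E * K y x)%E).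
  exact: emeasurable_funM.
have VK0 x y : (0 <= (aV h y)%:E * K y x)%E.
  by rewrite mule_ge0// lee_fin cabs_ge0.
apply: le_trans (overlap_sum_le (P := fun x => \int[mu]_y f (x, y))%E
    mU (UN J) D_gt0 DU _ _ _ _) _.
- exact: measurable_partial_integral.
- by move=> x; exact: integral_ge0.
- move=> i; apply: mule_ge0; first exact: H1enorm_ge0.
  apply: integral_ge0 => y _.
  by rewrite lee_fin mulr_ge0 ?cabs_ge0.
- move=> i; have := qA i; apply: filterS => x qx Uix.
  rewrite /f/= ge0_integralZl//; last by rewrite lee_fin mulr_ge0// ltW.
  apply: lee_pmul => //; first exact: H1enorm_ge0.
  - by apply: integral_ge0 => y _; rewrite lee_fin mulr_ge0 ?cabs_ge0.
  - exact: qx.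
  apply: le_integralT => //; first exact: measurable_voice_mul.
    by move=> y; rewrite lee_fin mulr_ge0 ?cabs_ge0.
  by move=> y; rewrite EFinM lee_wpmul2l ?p_le// lee_fin cabs_ge0.
rewrite [(N%:R / D * _)%:E]EFinM -muleA lee_wpmul2l//.
  by rewrite lee_fin divr_ge0// ltW.
rewrite sigma_finite_tonelli//.
rewrite /H1enorm -ge0_integralZl//; last 3 first.
- exact: measurable_voice_weight.
- by move=> y _; rewrite lee_fin mulr_ge0 ?cabs_ge0 ?ltW.
- by rewrite lee_fin mulr_ge0.
apply: ae_ge0_le_integral => //.
- by move=> y _; exact: integral_ge0.
- pose g z := f (z.2, z.1).
  apply: (@measurable_partial_integral _ _ _ _ mu_sf g) => [|z]; last exact: f0.
  apply: (measurableT_comp mf (g := fun z => (z.2, z.1))).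
  exact: measurable_fun_pair.
- move=> y _; rewrite -EFinM lee_fin mulr_ge0 ?mulr_ge0 ?cabs_ge0//.
  by rewrite ltW.
- apply: emeasurable_funM; first exact: measurable_cst.
  exact: measurable_voice_weight.
move: KB; apply: filterS => y KB _; rewrite /f/=.
rewrite (_ : (\int[mu]_x _ = (A * aV h y)%:E *
    \int[mu]_x (K y x * (nu x)%:E))%E); last first.
  rewrite -ge0_integralZl//.
  - by apply: eq_integral => x _; rewrite !EFinM muleACA [((nu x)%:E * _)%E]muleC.
  - apply: emeasurable_funM; first exact: measurable_kernel_row.
    by apply/measurable_EFinP; exact: nu_weight.1.
  - by move=> x _; rewrite mule_ge0// lee_fin ltW.
  - by rewrite lee_fin mulr_ge0 ?cabs_ge0.
apply: le_trans (lee_wpmul2l _ KB) _; first by rewrite lee_fin mulr_ge0 ?cabs_ge0.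
by rewrite -!EFinM lee_fin le_eqVlt; apply/orP; left; apply/eqP; ring.
Qed.

End frame_atoms.
End atoms.

(** * Term-by-term expansions of antidual elements *)

Section dual_expansions.
Context {X : ptopologicalType} {R : realType}.
Variable mu : {measure set (borel X) -> \bar R}.
Context {H : completeNormedModType R[i]}.
Variable dot : {dot H for (fun z : R[i] => z^*)}.
Variables (phi : borel X -> H) (nu : borel X -> R).
Hypothesis dot_norm : forall f, dot f f = `|f| ^+ 2.
Hypothesis phi_parseval : parseval_frame mu dot phi.
Hypothesis nu_weight : weight nu.
Variable CB : R.
Hypothesis CB_gt0 : 0 < CB.
Hypothesis phi_bound : forall x, `|phi x| <= (CB * nu x)%:C%C.
Context {n : nat} {I : choiceType}.
Hypothesis I_countable : countable [set: I].
Variables p q : 'I_n -> I -> H.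

Local Notation aV h y := (cabs (dot h (phi y))).
Local Notation H1enorm := (H1enorm mu dot phi nu).
Local Notation H1 := (H1 mu dot phi nu).
Local Notation antidual := (antidual mu dot phi nu).
Implicit Types (J : {fset I}) (h u : H).

Hypothesis phi_H1 : forall x, H1 (phi x).
Hypothesis q_H1 : forall r i, H1 (q r i).
Variable C0 : R.
Hypothesis C0_ge0 : 0 <= C0.
Hypothesis atoms_bound : forall r J h,
  (\sum_(i <- J) H1enorm (q r i) * \int[mu]_y (aV h y * aV (p r i) y)%:E
     <= C0%:E * H1enorm h)%E.
Hypothesis expansion : forall u h,
  (fun J => \sum_r \sum_(i <- J) dot u (q r i) * dot (p r i) h) @ totally
    --> (dot u h : R[i]^o).

(** [b h r i] bounds the norm in H_1^nu of the [i]-th term of the dual series of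
[h] and, up to the norm of [f], that of the expansion of [f] paired with [h]. *)
Let Ipq h r i : R := fine (\int[mu]_y (aV h y * aV (p r i) y)%:E)%E.
Let b h r i : R := fine (H1enorm (q r i)) * Ipq h r i.

Let IpqE h r i : H1 h ->
  (Ipq h r i)%:E = (\int[mu]_y (aV h y * aV (p r i) y)%:E)%E.
Proof.
move=> /(H1E _ _ _ nu_weight) hH; rewrite fineK// ge0_fin_numE; last first.
  by apply: integral_ge0 => y _; rewrite lee_fin mulr_ge0 ?cabs_ge0.
under eq_integral do rewrite mulrC.
apply: le_lt_trans (int_voice_le_H1enorm dot_norm phi_parseval nu_weight CB_gt0
  phi_bound (p r i) h) _.
have := H1enorm_ge0 mu dot phi nu_weight h; case: (H1enorm h) hH => // x _ _.
by rewrite -EFinM ltry.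
Qed.

Let q_enormE r i : (fine (H1enorm (q r i)))%:E = H1enorm (q r i).
Proof.
by rewrite fineK// ge0_fin_numE ?H1enorm_ge0//; apply/(H1E _ _ _ nu_weight).
Qed.

Let bE h r i : H1 h -> (b h r i)%:E =
  (H1enorm (q r i) * \int[mu]_y (aV h y * aV (p r i) y)%:E)%E.
Proof. by move=> hH; rewrite /b EFinM q_enormE IpqE. Qed.

Let Ipq_ge0 h r i : 0 <= Ipq h r i.
Proof.
by apply: fine_ge0; apply: integral_ge0 => y _; rewrite lee_fin mulr_ge0 ?cabs_ge0.
Qed.

Let b_ge0 h r i : 0 <= b h r i.
Proof. by rewrite mulr_ge0// fine_ge0// H1enorm_ge0. Qed.

Let b_sum h r J : H1 h -> \sum_(i <- J) b h r i <= C0 * fine (H1enorm h).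
Proof.
move=> hH; rewrite -lee_fin EFinM fineK; last first.
  by rewrite ge0_fin_numE ?H1enorm_ge0//; apply/(H1E _ _ _ nu_weight).
rewrite -sumEFin; under eq_bigr do rewrite bE//.
exact: atoms_bound.
Qed.

Let bb h i := \sum_r b h r i.

Let bb_tail h e : H1 h -> 0 < e -> exists J0, forall J J', (J0 `<=` J)%fset ->
  (J `<=` J')%fset -> \sum_(i <- (J' `\` J)%fset) bb h i <= e.
Proof.
move=> hH; apply: (summable_tail (M := \sum_(r < n) (C0 * fine (H1enorm h)))).
  by move=> i; exact: sumr_ge0.
by move=> J; rewrite exchange_big/=; apply: ler_sum => r _; exact: b_sum.
Qed.

Let cabs_dot_p h r i : H1 h -> cabs (dot (p r i) h) <= Ipq h r i.
Proof.
move=> hH; rewrite -lee_fin IpqE// cabs_dotC.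
exact: dot_le_voice.
Qed.

Let int_voice_sum2 (w : borel X -> R) J (c : 'I_n -> I -> R[i])
    (u : 'I_n -> I -> H) :
  measurable_fun [set: borel X] w -> (forall y, 0 <= w y) ->
  (\int[mu]_y (aV (\sum_r \sum_(i <- J) c r i *: u r i)%R y * w y)%:E <=
   \sum_(i <- J) \sum_r
     (cabs (c r i))%:E * \int[mu]_y (aV (u r i) y * w y)%:E)%E.
Proof.
move=> mw w0.
rewrite (_ : \sum_r \sum_(i <- J) c r i *: u r i =
    \sum_(i <- J) (1 : R[i]) *: \sum_r c r i *: u r i); last first.
  by rewrite exchange_big/=; apply: eq_bigr => i _; rewrite scale1r.
apply: le_trans (int_voice_sum phi_parseval _ _ _ mw w0) _.
apply: lee_sum => i _; rewrite Normc.normc1 mul1e.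
exact: int_voice_sum.
Qed.

Let dual_sum h J : H := \sum_r \sum_(i <- J) dot h (p r i) *: q r i.

Let dual_sumE h J : dual_sum h J =
  \sum_r (1 : R[i]) *: (\sum_(i <- J) dot h (p r i) *: q r i).
Proof. by apply: eq_bigr => r _; rewrite scale1r. Qed.

Let dual_sum_H1 h J : H1 (dual_sum h J).
Proof. by rewrite dual_sumE; apply: H1_sum => // r; exact: H1_sum. Qed.

Let antidual_dual_sum f h J : antidual f ->
  f (dual_sum h J) = \sum_r \sum_(i <- J) f (q r i) * dot (p r i) h.
Proof.
move=> fA; rewrite dual_sumE (antidual_sum phi_parseval nu_weight _ _ fA);
  last by move=> r; exact: H1_sum.
apply: eq_bigr => r _; rewrite rmorph1 mul1r.
rewrite (antidual_sum phi_parseval nu_weight _ _ fA)//.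
by apply: eq_bigr => i _; rewrite -dot_conj mulrC.
Qed.

(** The weak expansion of H identifies the pointwise limit of the voice
transforms of the partial sums as that of [h]; absolute convergence bounds the
distance between two partial sums, and Fatou's lemma passes to the limit. *)
Let H1enorm_dual_sum_tail h e : H1 h -> 0 < e -> exists J0, forall J,
  (J0 `<=` J)%fset -> (H1enorm (h - dual_sum h J)%R <= e%:E)%E.
Proof.
move=> hH e0; have [J_ J_cof] := countable_cofinal I_countable.
have [J0 J0e] := bb_tail hH e0; exists J0 => J J0J.
have dcvg v : (fun J => dot (dual_sum h J) v) @ totally --> (dot h v : R[i]^o).
  apply/cvg_cabsP => d d0; have /cvg_cabsP/(_ d d0) := @expansion v h.
  have vA := dot_antidual dot_norm phi_parseval nu_weight CB_gt0 phi_bound v.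
  apply: filterS => J'; rewrite -(antidual_dual_sum h J' vA).
  by rewrite -!dotBr cabs_dotC !dotBl.
apply: (@fatou_le _ _ _ mu
  (fun k y => aV (dual_sum h (J_ k) - dual_sum h J) y * nu y)).
- by move=> k; apply/measurable_EFinP; exact: measurable_voice_weight.
- by move=> k y; rewrite mulr_ge0 ?cabs_ge0 ?weight_ge0.
- move=> y; apply: cvgM; last exact: cvg_cst.
  under eq_fun do rewrite dotBl; rewrite dotBl; apply: cvg_cabsB.
  exact: cvg_comp J_cof (dcvg (phi y)).
have := near_cofinal J J_cof; apply: filterS => k JJk.
rewrite /dual_sum -sumrB; under eq_bigr do rewrite big_fset_diff//.
apply: le_trans (int_voice_sum2 _ _ _ _ _) _; first exact: nu_weight.1.
  by move=> y; exact: weight_ge0.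
apply: le_trans (_ : \sum_(i <- (J_ k `\` J)%fset) (bb h i)%:E <= _)%E.
  apply: lee_sum => i _; rewrite /bb -sumEFin; apply: lee_sum => r _.
  rewrite -/(H1enorm (q r i)) -q_enormE -EFinM lee_fin /b mulrC ler_wpM2l//.
    by rewrite fine_ge0// H1enorm_ge0.
  by rewrite cabs_dotC cabs_dot_p.
by rewrite sumEFin lee_fin J0e.
Qed.

(** The dual series of [h] converges to [h] in H_1^nu, hence [f] may be applied
to it term by term. *)
Lemma antidual_expansion f h : antidual f -> H1 h ->
  (fun J => \sum_r \sum_(i <- J) f (q r i) * dot (p r i) h) @ totally
    --> (f h : R[i]^o).
Proof.
move=> fA hH; have [Cf Cf0 fC] := antidual_bound nu_weight fA.
apply/cvg_cabsP => e e0; have C1 : 0 < Cf + 1 by rewrite ltr_wpDl.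
have [J0 J0e] := H1enorm_dual_sum_tail hH (divr_gt0 e0 C1).
exists J0 => // J /= /J0e Je; rewrite -(antidual_dual_sum h J fA) cabsC.
rewrite -(antidualB fA)//.
rewrite -lee_fin; apply: le_trans (fC _ _) _; first exact: H1B.
apply: le_trans (lee_wpmul2l _ Je) _; first by rewrite lee_fin.
by rewrite -EFinM lee_fin mulrA ler_pdivrMr// mulrC ler_wpM2l ?lerDl// ltW.
Qed.

Let primal_sum (f : H -> R[i]) J : H :=
  \sum_r \sum_(i <- J) f (q r i) *: p r i.

Let dot_primal_sum f J v : dot (primal_sum f J) v =
  \sum_r \sum_(i <- J) f (q r i) * dot (p r i) v.
Proof.
rewrite dot_suml; apply: eq_bigr => r _; rewrite dot_suml.
by apply: eq_bigr => i _; rewrite dotZl.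
Qed.

(** The partial sums of the expansion of [f] lie in H, where Parseval gives the
inequality; replacing their voice transforms by that of [f] costs the tail of a
summable family. *)
Lemma antidual_abs_le f h : antidual f -> cmeasurable (voice phi f) -> H1 h ->
  ((cabs (f h))%:E <= \int[mu]_y (cabs (f (phi y)) * aV h y)%:E)%E.
Proof.
move=> fA mf hH; have [Cf Cf0 fC] := antidual_bound nu_weight fA.
have [J_ J_cof] := countable_cofinal I_countable.
have C1 : 0 < Cf + 1 by rewrite ltr_wpDl.
have mh := voice_abs_measurable phi_parseval h.
apply/lee_addgt0Pr => e e0; have e2 : 0 < e / 2 by rewrite divr_gt0.
have [J0 J0e] := bb_tail hH (divr_gt0 e2 C1).
have /cvg_cabsP/(_ _ e2) fh := antidual_expansion fA hH.
have [J [/= fJ J0J]] := filter_ex (filterI fh (near_totally_sub J0)).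
rewrite -dot_primal_sum in fJ.
have mD : measurable_fun [set: borel X]
    (fun y => cabs (f (phi y) - dot (primal_sum f J) (phi y))).
  by apply: measurable_cabs; apply: cmeasurableB => //; exact: voice_cmeasurable.
have tail : (\int[mu]_y (cabs (f (phi y) - dot (primal_sum f J) (phi y)) *
    aV h y)%:E <= (e / 2)%:E)%E.
  apply: (@fatou_le _ _ _ mu
    (fun k y => aV (primal_sum f (J_ k) - primal_sum f J) y * aV h y)).
  - by move=> k; apply: measurable_funM => //; exact: voice_abs_measurable.
  - by move=> k y; rewrite mulr_ge0 ?cabs_ge0.
  - move=> y; apply: cvgM; last exact: cvg_cst.
    under eq_fun do rewrite dotBl; apply: cvg_cabsB.
    have fy := antidual_expansion fA (phi_H1 y).
    apply: (cvg_comp J_ (fun J => dot (primal_sum f J) (phi y)) J_cof).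
    by rewrite (funext (fun J' => dot_primal_sum f J' (phi y))).
  have := near_cofinal J J_cof; apply: filterS => k JJk.
  rewrite /primal_sum -sumrB; under eq_bigr do rewrite big_fset_diff//.
  apply: le_trans (int_voice_sum2 _ _ _ mh _) _; first by move=> y; exact: cabs_ge0.
  apply: le_trans (_ : \sum_(i <- (J_ k `\` J)%fset) (Cf * bb h i)%:E <= _)%E.
    apply: lee_sum => i _; rewrite /bb mulr_sumr -sumEFin; apply: lee_sum => r _.
    under eq_integral do rewrite mulrC.
    rewrite -IpqE// -EFinM lee_fin /b mulrA ler_wpM2r//.
    by rewrite -lee_fin EFinM q_enormE; exact: fC.
  rewrite sumEFin lee_fin -mulr_sumr (le_trans (ler_wpM2l Cf0 (J0e _ _ J0J JJk)))//.
  by rewrite mulrA ler_pdivrMr// mulrC ler_wpM2l ?lerDl// ltW.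
apply: le_trans (_ : (cabs (dot (primal_sum f J) h))%:E + (e / 2)%:E <= _)%E.
  rewrite -EFinD lee_fin -[X in cabs X <= _](subrK (dot (primal_sum f J) h)).
  by rewrite addrC (le_trans (cabsD _ _))// lerD// cabsC.
rewrite [X in (_ <= _ + X%:E)%E]splitr EFinD addeA leeD2r//.
apply: le_trans (dot_le_voice dot_norm phi_parseval _ _) _.
apply: le_trans (leeD2l _ tail); rewrite -ge0_integralD//.
- apply: le_integralT.
  + exact: measurable_voice_mul.
  + apply: emeasurable_funD; apply/measurable_EFinP/measurable_funM => //.
    exact: measurable_cabs mf.
  + by move=> y; rewrite lee_fin mulr_ge0 ?cabs_ge0.
  + move=> y; rewrite -EFinD lee_fin -mulrDl ler_wpM2r ?cabs_ge0//.
    rewrite addrC -[X in cabs X <= _](subrK (f (phi y))) (le_trans (cabsD _ _))//.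
    by rewrite lerD2r cabsC.
- by move=> y _; rewrite lee_fin mulr_ge0 ?cabs_ge0.
- by apply/measurable_EFinP/measurable_funM => //; exact: measurable_cabs mf.
- by move=> y _; rewrite lee_fin mulr_ge0 ?cabs_ge0.
- by apply/measurable_EFinP/measurable_funM.
Qed.

Definition expansion_limits (f : H -> R[i]) r h : set R[i] := fun s =>
  (fun J => \sum_(i <- J) f (q r i) * dot (p r i) h) @ totally
    --> (s : R[i]^o).

(** The sum of the [r]-th inner series, with the value 0 where it diverges; for
[f] in the antidual it converges absolutely on H_1^nu. *)
Definition expansion_part (f : H -> R[i]) r h : R[i] :=
  xget 0 (expansion_limits f r h).

Let expansion_part_bound f : antidual f -> exists2 C : R, 0 <= C &
  forall r h J, H1 h ->
    \sum_(i <- J) cabs (f (q r i) * dot (p r i) h) <= C * fine (H1enorm h).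
Proof.
move=> fA; have [Cf Cf0 fC] := antidual_bound nu_weight fA.
exists (Cf * C0) => [|r h J hH]; first exact: mulr_ge0.
apply: le_trans (_ : \sum_(i <- J) Cf * b h r i <= _); last first.
  by rewrite -mulr_sumr -mulrA ler_wpM2l// b_sum.
apply: ler_sum => i _; rewrite cabsM /b mulrA ler_pM ?cabs_ge0 ?cabs_dot_p//.
by rewrite -lee_fin EFinM q_enormE; exact: fC.
Qed.

Lemma expansion_part_cvg f r h : antidual f -> H1 h ->
  (fun J => \sum_(i <- J) f (q r i) * dot (p r i) h) @ totally
    --> (expansion_part f r h : R[i]^o).
Proof.
move=> fA hH; have [C C_ge0 fC] := expansion_part_bound fA.
have [s ss] := abs_summable_cvg (fun J => fC r h J hH).
have : exists t, expansion_limits f r h t by exists s.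
exact: xgetPex.
Qed.

Lemma expansion_part_antidual f r : antidual f -> antidual (expansion_part f r).
Proof.
move=> fA; split=> [a u v uH vH|].
  have uvH : H1 (a *: u + v) by apply: H1D => //; exact: H1Z.
  apply: ccvg_unique (expansion_part_cvg (r := r) fA uvH) _.
  rewrite (_ : (fun J => _) = fun J =>
      a^* * \sum_(i <- J) f (q r i) * dot (p r i) u +
      \sum_(i <- J) f (q r i) * dot (p r i) v); last first.
    apply/funext => J; rewrite mulr_sumr -big_split/=; apply: eq_bigr => i _.
    by rewrite dotDr dotZr mulrDr mulrCA.
  by apply: ccvg_lin; exact: expansion_part_cvg.
have [C C_ge0 fC] := expansion_part_bound fA; exists C => u uH.
apply: cabs_lim_le (expansion_part_cvg (r := r) fA uH) _; apply: nearW => J.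
rewrite (le_trans (cabs_sum _ _))// (le_trans (fC _ _ _ uH))//.
by rewrite /H1norm H1enormE.
Qed.

Lemma expansion_part_sum f h : antidual f -> H1 h ->
  f h = \sum_r expansion_part f r h.
Proof.
move=> fA hH; apply: ccvg_unique (antidual_expansion fA hH) _.
by apply: ccvg_sum => r; exact: expansion_part_cvg.
Qed.

End dual_expansions.

(** * Solid function spaces and their sequence spaces *)

Section function_spaces.
Context {X : ptopologicalType} {R : realType}.
Variable mu : {measure set (borel X) -> \bar R}.
Variable Y : qbf_space mu.

Lemma qbfZ (a : R[i]) F : Y F -> Y (fun x => a * F x).
Proof.
move=> YF; have := qbf_linear a YF (qbf0 Y).
rewrite (_ : (fun x => _) = (fun x => a * F x))//.
by apply/funext => x; rewrite addr0.
Qed.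

Lemma qbfD F G : Y F -> Y G -> Y (fun x => F x + G x).
Proof.
move=> YF YG; have := qbf_linear 1 YF YG.
rewrite (_ : (fun x => _) = (fun x => F x + G x))//.
by apply/funext => x; rewrite mul1r.
Qed.

Lemma qbf_sum (J : Type) (s : seq J) : exists2 C : R, 0 <= C &
  forall F : J -> borel X -> R[i], (forall j, Y (F j)) ->
  Y (fun x => \sum_(j <- s) F j x) /\
  qnorm Y (fun x => \sum_(j <- s) F j x) <= C * \sum_(j <- s) qnorm Y (F j).
Proof.
have [D YD] := qnormD Y; elim: s => [|j s [C C0 IH]].
  exists 0 => // F _; under eq_fun do rewrite big_nil.
  split; first exact: qbf0.
  have := qnormZ 0 (qbf0 Y); rewrite cabs0 !mul0r => ->; exact: lexx.
exists (`|D| * (1 + C)); first by rewrite mulr_ge0// addr_ge0.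
move=> F YF; have [Ys ns] := IH F YF; under eq_fun do rewrite big_cons.
split; first exact: qbfD.
rewrite (le_trans (YD _ _ (YF j) Ys))// big_cons.
have Fj0 := qnorm_ge0 (YF j); have Fs0 := qnorm_ge0 Ys.
have S0 : 0 <= \sum_(j <- s) qnorm Y (F j).
  by apply: sumr_ge0 => i _; exact: qnorm_ge0.
rewrite (le_trans (ler_wpM2r _ (ler_norm D))) ?addr_ge0//.
rewrite -mulrA ler_wpM2l// mulrDl mul1r lerD//.
  by rewrite lerDl.
by rewrite (le_trans ns)// ler_wpM2l// lerDr.
Qed.

Hypothesis Y_solid : solid Y.

Lemma qbf_abs G : Y G -> Y (fun y => (cabs (G y))%:C%C) /\
  qnorm Y (fun y => (cabs (G y))%:C%C) <= qnorm Y G.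
Proof.
move=> YG; apply: Y_solid => //.
  by apply/cmeasurable_real/measurable_cabs; exact: qbf_measurable YG.
by apply: nearW => x; rewrite cabs_real ger0_norm ?cabs_ge0.
Qed.

Section kernel_operators.
Variable K : borel X -> borel X -> \bar R.
Hypothesis K_ge0 : forall x y, (0 <= K x y)%E.
Hypothesis mK : measurable_fun [set: borel X * borel X]
  (fun p : borel X * borel X => K p.1 p.2).
Hypothesis K_fin : \forall x \ae mu, \forall y \ae mu, K x y \is a fin_num.
Hypothesis K_bounded : bounded_on Y (fun x y => (fine (K x y))%:C%C).

(** For almost every [x] the row of [K] is finite almost everywhere and the
integral converges, so that the extended integral on the right is the value at
[x] of the operator on Y; the rest is solidity. *)
Lemma kernel_dominates : exists2 C : R, 0 <= C &
  forall (g : borel X -> R) (a : R) (F : borel X -> R[i]),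
  (forall x, 0 <= g x) -> Y (fun x => (g x)%:C%C) -> 0 <= a ->
  cmeasurable F ->
  (forall x, (cabs (F x))%:E <= a%:E * \int[mu]_y ((g y)%:E * K x y))%E ->
  Y F /\ qnorm Y F <= C * a * qnorm Y (fun x => (g x)%:C%C).
Proof.
have [C KC] := K_bounded; exists `|C| => // g a F g0 Yg a0 mF Fle.
have [Kint YK nK] := KC _ Yg; set k := kernel_op _ _ _ in YK nK *.
have FK : \forall x \ae mu, cabs (F x) <= cabs (a%:C%C * k x).
  move: Kint K_fin; apply: filterS2 => x [Kint _] Kxfin.
  rewrite cabsM cabs_real ger0_norm//.
  apply: (@le_trans _ _ (a * Re (k x))); last first.
    by rewrite ler_wpM2l// (le_trans _ (ler_Re_cabs _))// ler_norm.
  have E : (fun y => (Re ((fine (K x y))%:C%C * (g y)%:C%C))%:E) =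
      fun y => (g y * fine (K x y))%:E.
    by apply/funext => y; rewrite -rmorphM/= mulrC.
  move: Kint; rewrite E => Kint.
  rewrite -lee_fin (le_trans (Fle x))// EFinM lee_wpmul2l ?lee_fin//.
  rewrite /k /kernel_op /cintegral/= E fineK; last exact: integrable_fin_num.
  apply: ae_ge0_le_integral => //.
  - by move=> y _; rewrite mule_ge0// lee_fin.
  - apply: emeasurable_funM; last exact: measurable_kernel_row.
    by apply/measurable_EFinP; have [] := qbf_measurable Yg.
  - by move=> y _; rewrite lee_fin mulr_ge0// fine_ge0.
  - by case/integrableP : Kint.
  by move: Kxfin; apply: filterS => y Kfin _; rewrite EFinM fineK.
have [YF nF] := Y_solid mF (qbfZ a%:C%C YK) FK; split=> //.
rewrite (le_trans nF)// qnormZ// cabs_real ger0_norm// -mulrA mulrCA ler_wpM2l//.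
by rewrite (le_trans nK)// ler_wpM2r ?ler_norm// qnorm_ge0.
Qed.

End kernel_operators.

Context {I : choiceType}.
Hypothesis I_countable : countable [set: I].
Variables (U : I -> set X) (N : nat) (D : R).
Hypothesis mU : forall i, measurable (U i : set (borel X)).
Hypothesis UN : forall (J : {fset I}) x, \sum_(i <- J) \1_(U i) x <= N%:R :> R.
Hypothesis U_fin : forall x, finite_set [set i | U i x].
Hypothesis D_gt0 : 0 < D.
Hypothesis DU : forall i, (D%:E <= mu (U i))%E.
Hypothesis muU_fin : forall i, (mu (U i) < +oo)%E.
Implicit Types (l eta : I -> R[i]) (J : {fset I}).

Definition natural_real l (x : borel X) : R := \sum_(i \in [set: I])
  cabs (l i) * (fine (mu (U i)))^-1 * \1_(U i) x.

Lemma muU_fineE i : (fine (mu (U i)))%:E = mu (U i).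
Proof. by rewrite fineK// ge0_fin_numE. Qed.

Lemma muU_geD i : D <= fine (mu (U i)).
Proof. by rewrite -lee_fin muU_fineE. Qed.

Lemma muU_gt0 i : 0 < fine (mu (U i)).
Proof. exact: lt_le_trans D_gt0 (muU_geD i). Qed.

Lemma natural_term_ge0 l i x :
  0 <= cabs (l i) * (fine (mu (U i)))^-1 * \1_(U i) x :> R.
Proof. by rewrite !mulr_ge0 ?cabs_ge0// invr_ge0 ltW// muU_gt0. Qed.

(** Every point lies in finitely many cells, so that the unordered sum is a
finite one over any large enough set of indices. *)
Lemma natural_realE l x : exists J0, forall J, (J0 `<=` J)%fset ->
  natural_real l x =
  \sum_(i <- J) cabs (l i) * (fine (mu (U i)))^-1 * \1_(U i) x.
Proof.
exists (fset_set [set i | U i x]) => J /fsubsetP J0J.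
apply: fsbigTE => i iJ; rewrite indicE; case: (boolP (x \in U i)) => [|_].
  move=> /set_mem Uix; move: iJ; rewrite J0J// in_fset_set//; exact/mem_set.
by rewrite mulr0.
Qed.

Lemma natural_real_ge0 l x : 0 <= natural_real l x.
Proof.
have [J /(_ J (fsubset_refl J)) ->] := natural_realE l x; apply: sumr_ge0 => i _.
exact: natural_term_ge0.
Qed.

Lemma natural_real_ge l J x :
  \sum_(i <- J) cabs (l i) * (fine (mu (U i)))^-1 * \1_(U i) x
    <= natural_real l x.
Proof.
have [J0 /(_ (J0 `|` J)%fset) -> ] := natural_realE l x; last exact: fsubsetUl.
rewrite -subr_ge0 big_fset_diff ?fsubsetUr//; apply: sumr_ge0 => i _.
exact: natural_term_ge0.
Qed.

Lemma natural_real_le l eta x : (forall i, cabs (l i) <= cabs (eta i)) ->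
  natural_real l x <= natural_real eta x.
Proof.
move=> le; have [J /(_ J (fsubset_refl J)) ->] := natural_realE l x.
apply: le_trans (natural_real_ge eta J x); apply: ler_sum => i _.
by rewrite -!mulrA ler_wpM2r// mulr_ge0// invr_ge0 ltW// muU_gt0.
Qed.

Lemma natural_real_le_sup l x (M : R) : 0 <= M ->
  (forall i, U i x -> cabs (l i) <= M) -> natural_real l x <= N%:R / D * M.
Proof.
move=> M0 lM; have [J /(_ J (fsubset_refl J)) ->] := natural_realE l x.
apply: le_trans (_ : \sum_(i <- J) M / D * \1_(U i) x <= _).
  apply: ler_sum => i _; rewrite indicE; case: (boolP (x \in U i)) => [|_].
    move=> /set_mem Uix; rewrite !mulr1; apply: ler_pM.
    - exact: cabs_ge0.
    - by rewrite invr_ge0 ltW// muU_gt0.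
    - exact: lM.
    by rewrite lef_pV2 ?posrE ?muU_gt0// muU_geD.
  by rewrite !mulr0.
rewrite -mulr_sumr mulrC [leRHS]mulrAC -[leRHS]mulrA ler_wpM2r//.
by rewrite divr_ge0// ltW.
Qed.

Lemma measurable_natural_real l : measurable_fun [set: borel X] (natural_real l).
Proof.
have [J_ J_cof] := countable_cofinal I_countable.
pose s k (x : borel X) : R := \sum_(i <- J_ k)
  cabs (l i) * (fine (mu (U i)))^-1 * \1_(U i) x.
apply: (@measurable_fun_cvg _ _ _ _ s) => [k|x _].
  apply: measurable_sum => i; apply: measurable_funM.
    exact: measurable_cst.
  exact: measurable_indic.
have [J0 lE] := natural_realE l x; apply: cvg_near_cst.
have := near_cofinal J0 J_cof; apply: filterS => k J0k.
by rewrite (lE _ J0k).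
Qed.

Lemma natural_funE l : natural_fun mu U l = fun x => (natural_real l x)%:C%C.
Proof. by []. Qed.

Lemma natural_space_le l eta : (forall i, cabs (l i) <= cabs (eta i)) ->
  natural_space U Y eta ->
  natural_space U Y l /\ natural_norm U Y l <= natural_norm U Y eta.
Proof.
move=> le Ye; apply: Y_solid => //.
  by rewrite natural_funE; apply: cmeasurable_real; exact: measurable_natural_real.
apply: nearW => x; rewrite !natural_funE !cabs_real !ger0_norm ?natural_real_ge0//.
exact: natural_real_le.
Qed.

Lemma natural_spaceB l eta : natural_space U Y l -> natural_space U Y eta ->
  natural_space U Y (fun i => l i - eta i).
Proof.
move=> Yl Ye.
apply: (proj1 (Y_solid
  (G := fun x => natural_fun mu U l x + natural_fun mu U eta x) _ _ _)).
- by rewrite natural_funE; apply: cmeasurable_real; exact: measurable_natural_real.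
- exact: qbfD.
apply: nearW => x; rewrite !natural_funE -rmorphD !cabs_real.
rewrite !ger0_norm ?addr_ge0 ?natural_real_ge0//.
have [J /(_ J (fsubset_refl J)) ->] := natural_realE (fun i => l i - eta i) x.
apply: le_trans (lerD (natural_real_ge l J x) (natural_real_ge eta J x)).
rewrite -big_split/=; apply: ler_sum => i _; rewrite -!mulrA -mulrDl.
apply: ler_wpM2r; first by rewrite mulr_ge0// invr_ge0 ltW// muU_gt0.
by rewrite (le_trans (cabsD _ _))// cabsN.
Qed.

(** Solidity makes truncation an optimal approximation: on the support of a
finite sequence eta the truncated remainder vanishes, off it eta does. *)
Lemma natural_space_tail l e : finite_sequences_dense U Y ->
  natural_space U Y l -> 0 < e -> \forall J \near totally,
    natural_space U Y (fun i => l i - (if i \in J then l i else 0)) /\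
    natural_norm U Y (fun i => l i - (if i \in J then l i else 0)) < e.
Proof.
move=> dense Yl e0; have [eta [eta_fin Yeta eta_e]] := dense _ Yl _ e0.
have := near_totally_sub (fset_set [set i | eta i != 0]).
apply: filterS => J etaJ.
have tail_le i : cabs (l i - (if i \in J then l i else 0)) <= cabs (l i - eta i).
  case: ifPn => iJ; first by rewrite subrr cabs0 cabs_ge0.
  rewrite (_ : eta i = 0)//; apply/eqP; apply: contraNT iJ => eta0.
  by apply: (fsubsetP etaJ); rewrite in_fset_set//; exact/mem_set.
have [Yt nt] := natural_space_le tail_le (natural_spaceB Yl Yeta).
by split=> //; exact: le_lt_trans nt eta_e.
Qed.

(** On the cell [U i] the function [k] dominates [c i], hence [c i] is at most the
mean of [k] over [U i]; integrating [k] against the step function of [l] adds up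
these means with the weights [cabs (l i)]. *)
Lemma natural_integral l (c : I -> R) (k : borel X -> \bar R) J :
  measurable_fun [set: borel X] k -> (forall x, 0 <= k x)%E ->
  (forall i, 0 <= c i) -> (forall i x, U i x -> ((c i)%:E <= k x)%E) ->
  ((\sum_(i <- J) cabs (l i) * c i)%:E <=
   \int[mu]_x ((natural_real l x)%:E * k x))%E.
Proof.
move=> mk k0 c0 ck.
have m1 i : measurable_fun [set: borel X] (fun x => (\1_(U i) x)%:E : \bar R).
  by apply/measurable_EFinP; exact: measurable_indic.
pose w i := cabs (l i) * (fine (mu (U i)))^-1.
have w0 i : 0 <= w i by rewrite mulr_ge0 ?cabs_ge0// invr_ge0 ltW// muU_gt0.
have mw i : measurable_fun [set: borel X] (fun x => (w i * \1_(U i) x)%:E).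
  by apply/measurable_EFinP/measurable_funM;
    [exact: measurable_cst|exact: measurable_indic].
have mwk i : measurable_fun [set: borel X] (fun x => (w i * \1_(U i) x)%:E * k x)%E.
  exact: emeasurable_funM.
have wk0 i x : (0 <= (w i * \1_(U i) x)%:E * k x)%E.
  by rewrite mule_ge0// lee_fin mulr_ge0.
have step i : ((cabs (l i) * c i)%:E <= \int[mu]_x ((w i * \1_(U i) x)%:E * k x))%E.
  rewrite (_ : (cabs (l i) * c i)%:E =
      \int[mu]_x ((w i * c i)%:E * (\1_(U i) x)%:E))%E; last first.
    rewrite ge0_integralZl//; last by rewrite lee_fin mulr_ge0.
    rewrite integral_indic// setIT -muU_fineE -EFinM /w; congr (_%:E).
    by rewrite [RHS]mulrAC divfK// gt_eqF// muU_gt0.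
  apply: le_integralT => //.
  - by apply: emeasurable_funM => //; exact: measurable_cst.
  - move=> x; apply: mule_ge0; first by rewrite lee_fin mulr_ge0.
    by rewrite lee_fin.
  move=> x; rewrite indicE; case: (boolP (x \in U i)) => [/set_mem Uix|_].
    by rewrite mulr1 mule1 EFinM lee_wpmul2l ?ck ?lee_fin.
  by rewrite mulr0 mule0 mul0e.
rewrite -sumEFin; apply: le_trans (lee_sum _ (fun i _ => step i)) _.
rewrite -ge0_integral_sum//; apply: le_integralT.
- exact: emeasurable_sum.
- apply: emeasurable_funM => //; apply/measurable_EFinP.
  exact: measurable_natural_real.
- by move=> x; exact: sume_ge0.
move=> x; rewrite -ge0_sume_distrl; last by move=> i _; rewrite lee_fin mulr_ge0.
by rewrite lee_wpmul2r// sumEFin lee_fin natural_real_ge.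
Qed.

Variable K : borel X -> borel X -> \bar R.
Hypothesis K_ge0 : forall x y, (0 <= K x y)%E.
Hypothesis mK : measurable_fun [set: borel X * borel X]
  (fun p : borel X * borel X => K p.1 p.2).
Hypothesis K_fin : \forall x \ae mu, \forall y \ae mu, K x y \is a fin_num.
Hypothesis K_bounded : bounded_on Y (fun x y => (fine (K x y))%:C%C).

(** At a point [x] every coefficient whose cell contains [x] is at most the
value of the kernel operator at [x], and at most [N] cells of measure at least
[D] contribute: the step function is at most [N / D] times that value. *)
Lemma natural_space_analysis : exists2 C : R, 0 <= C &
  forall G l, Y G ->
  (forall i x, U i x -> ((cabs (l i))%:E <=
     \int[mu]_y ((cabs (G y))%:E * K x y))%E) ->
  natural_space U Y l /\ natural_norm U Y l <= C * qnorm Y G.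
Proof.
(* the successor makes the factor positive, so that it preserves +oo *)
pose a := N.+1%:R / D; have a0 : 0 < a by rewrite divr_gt0.
have [C C0 KC] := kernel_dominates K_ge0 mK K_fin K_bounded.
exists (C * a) => [|G l YG lG]; first by rewrite mulr_ge0// ltW.
have [YG' nG] := qbf_abs YG.
have [||Yl nl] := KC (fun y => cabs (G y)) a (natural_fun mu U l)
  (fun y => cabs_ge0 _) YG' (ltW a0).
- by rewrite natural_funE; apply: cmeasurable_real; exact: measurable_natural_real.
- move=> x; rewrite natural_funE cabs_real ger0_norm ?natural_real_ge0//.
  have : (0 <= \int[mu]_y ((cabs (G y))%:E * K x y))%E.
    by apply: integral_ge0 => y _; rewrite mule_ge0// lee_fin cabs_ge0.
  have := fun i => lG i x; case: (\int[mu]_y _)%E => // [M lM M0|_ _].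
    rewrite -EFinM lee_fin (le_trans (natural_real_le_sup M0 lM))//.
    by rewrite ler_wpM2r// ler_wpM2r ?invr_ge0 ?(ltW D_gt0)// ler_nat.
  by rewrite gt0_muley ?leey.
- split=> //; apply: le_trans nl _; apply: ler_wpM2l nG.
  by rewrite mulr_ge0// ltW.
Qed.

(** By [natural_integral], the moduli of the partial sums at [y] are bounded by
the integral of the step function of [l] against the row [K y]; the bound
passes to the limit. *)
Lemma natural_space_synthesis : exists2 C : R, 0 <= C &
  forall (l : I -> R[i]) (a : I -> borel X -> R[i]) (F : borel X -> R[i]),
  natural_space U Y l -> (forall i, cmeasurable (a i)) ->
  (forall i x y, U i x -> ((cabs (a i y))%:E <= K y x)%E) ->
  (forall y, (fun J => \sum_(i <- J) l i * a i y) @ totally --> (F y : R[i]^o)) ->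
  Y F /\ qnorm Y F <= C * natural_norm U Y l.
Proof.
have [C C0 KC] := kernel_dominates K_ge0 mK K_fin K_bounded.
exists C => // l a F Yl ma aK aF.
have [J_ J_cof] := countable_cofinal I_countable.
have mF : cmeasurable F.
  apply: (@cmeasurable_cvg _ _ _ (fun k y => \sum_(i <- J_ k) l i * a i y)).
    by move=> k; exact: cmeasurable_sum.
  move=> y; apply: (cvg_comp J_ (fun J => \sum_(i <- J) l i * a i y) J_cof).
  exact: aF.
have [|YF nF] := KC (natural_real l) 1 F (natural_real_ge0 l) Yl ler01 mF.
  move=> y; rewrite mul1e; have kJ J : ((\sum_(i <- J) cabs (l i) * cabs (a i y))%:E
      <= \int[mu]_x ((natural_real l x)%:E * K y x))%E.
    apply: natural_integral => //; first exact: measurable_kernel_row.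
      by move=> i; exact: cabs_ge0.
    by move=> i x; exact: aK.
  move: kJ; have : (0 <= \int[mu]_x ((natural_real l x)%:E * K y x))%E.
    by apply: integral_ge0 => x _; rewrite mule_ge0// lee_fin natural_real_ge0.
  case: (\int[mu]_x _)%E => // [M M0 kJ|_ _]; last exact: leey.
  rewrite lee_fin; apply: cabs_lim_le (aF y) _; apply: nearW => J.
  rewrite (le_trans (cabs_sum _ _))//; under eq_bigr do rewrite cabsM.
  by have := kJ J; rewrite lee_fin.
by split=> //; rewrite mulr1 in nF.
Qed.

End function_spaces.

(** * Atomic decomposition of the coorbit space *)

Section supremum_kernels.
Context {X : ptopologicalType} {R : realType}.
Context {H : completeNormedModType R[i]}.
Variable dot : {dot H for (fun z : R[i] => z^*)}.
Variables (psi phi : borel X -> H).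
Context {I : choiceType}.
Variable U : I -> set X.

Lemma sup_kernel_ge0 x y : \bigcup_i U i = [set: X] ->
  (0 <= sup_kernel dot U psi phi x y)%E.
Proof.
move=> UX; have [i _ Uiy] : (\bigcup_i U i) y by rewrite UX.
apply: le_trans (_ : (cabs (dot (phi x) (psi y)))%:E <= _)%E.
  by rewrite lee_fin cabs_ge0.
by apply: ereal_sup_ubound; exists y => //; exists i.
Qed.

Lemma sup_kernel_ge i x y z : U i y -> U i z ->
  ((cabs (dot (psi z) (phi x)))%:E <= sup_kernel dot U psi phi x y)%E.
Proof.
move=> Uiy Uiz; rewrite cabs_dotC; apply: ereal_sup_ubound.
by exists z => //; exists i.
Qed.

End supremum_kernels.

Section norm_expansions.
Context {R : realType} {H : completeNormedModType R[i]}.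
Variable dot : {dot H for (fun z : R[i] => z^*)}.
Hypothesis dot_norm : forall f, dot f f = `|f| ^+ 2.

Lemma dot_cvg (T : Type) (F : set_system T) (FF : Filter F) (x : T -> H)
    (g h : H) : x @ F --> g ->
  (fun t => dot (x t) h) @ F --> (dot g h : R[i]^o).
Proof.
move=> /cvgrPdistC_le xg; apply/cvg_cabsP => e e0.
have h1 : 0 < rnorm h + 1 by rewrite ltr_wpDl ?rnorm_ge0.
have := xg (e / (rnorm h + 1))%:C%C; rewrite ltcR divr_gt0// => /(_ isT).
apply: filterS => t; rewrite normE lecR => xt.
rewrite -dotBl (le_trans (cauchy_schwarz dot_norm _ _))//.
rewrite (le_trans (ler_wpM2r (rnorm_ge0 h) xt))// mulrAC ler_pdivrMr//.
by rewrite ler_wpM2l ?(ltW e0)// lerDl.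
Qed.

End norm_expansions.

Section partial_sums.
Context {X : ptopologicalType} {R : realType}.
Context {H : completeNormedModType R[i]}.
Variable dot : {dot H for (fun z : R[i] => z^*)}.
Hypothesis dot_norm : forall f, dot f f = `|f| ^+ 2.
Context {n : nat} {I : choiceType}.
Variables (psi psit : 'I_n -> borel X -> H) (x_ : I -> X).

Lemma dot_partial_sum f r (J : {fset I}) h :
  dot (partial_sum (expansion_term psi psit x_ f r) J) h =
  \sum_(i <- J) f (psit r (x_ i)) * dot (psi r (x_ i)) h.
Proof.
rewrite /partial_sum -(big_seq_fsetE _ _ xpredT (expansion_term psi psit x_ f r)).
by rewrite dot_suml; apply: eq_bigr => i _; rewrite dotZl.
Qed.

(** Convergence in norm is weakened to convergence of inner products: only the
scalar series enters the duality argument. *)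
Lemma expands_H_dot u h : expands_H dot psi psit x_ u ->
  (fun J : {fset I} => \sum_r \sum_(i <- J)
     dot u (psit r (x_ i)) * dot (psi r (x_ i)) h) @ totally
    --> (dot u h : R[i]^o).
Proof.
move=> [g gcvg ug].
have -> : dot u h = \sum_r dot (g r) h by rewrite {1}ug dot_suml.
apply: ccvg_sum => r.
have := dot_cvg dot_norm (h := h) (totally_filter : Filter _) (gcvg r).
by rewrite (funext (fun J => dot_partial_sum (dot u) r J h)).
Qed.

End partial_sums.

Section atomic_decomposition.
Context {R : realType} {X : ptopologicalType}.
Variable mu : {measure set (borel X) -> \bar R}.
Context {H : completeNormedModType R[i]}.
Variable dot : {dot H for (fun z : R[i] => z^*)}.
Variables (phi : borel X -> H) (nu : borel X -> R) (Y : qbf_space mu).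
Context {n : nat} {I : choiceType}.
Variables (psi psit : 'I_n -> borel X -> H) (U : I -> set X) (D : R) (x_ : I -> X).
Hypothesis X_hausdorff : hausdorff_space X.
Hypothesis X_sigma_compact : sigma_compact X.
Hypothesis mu_radon : radon_measure mu.
Hypothesis dot_norm : forall f, dot f f = `|f| ^+ 2.
Hypothesis phi_parseval : parseval_frame mu dot phi.
Hypothesis phi_H1 : forall x, H1 mu dot phi nu (phi x).
Hypothesis Y_solid : solid Y.
Hypothesis nu_weight : weight nu.
Variable CB : R.
Hypothesis CB_gt0 : 0 < CB.
Hypothesis phi_bound : forall x, `|phi x| <= (CB * nu x)%:C%C.
Hypothesis U_adm : admissible_covering U.
Hypothesis D_gt0 : 0 < D.
Hypothesis DU : forall i, (D%:E <= mu (U i))%E.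
Hypothesis psi_kernel : forall r, in_BYm Y nu (sup_kernel dot U (psi r) phi).
Hypothesis psit_kernel : forall r,
  in_BYm Y nu (sup_kernel_adj dot U (psit r) phi).
Hypothesis x_U : forall i, U i (x_ i).
Hypothesis expansion_H : forall f : H, expands_H dot psi psit x_ f.

Let p r i := psi r (x_ i).
Let q r i := psit r (x_ i).
Let K r := sup_kernel dot U (psi r) phi.
Let Kt r := sup_kernel_adj dot U (psit r) phi.

Local Notation aV h y := (cabs (dot h (phi y))).
Local Notation H1enorm := (H1enorm mu dot phi nu).
Local Notation H1 := (H1 mu dot phi nu).
Local Notation antidual := (antidual mu dot phi nu).
Local Notation coorbit := (coorbit dot phi nu Y).

Let mu_sf := radon_sigma_finite X_hausdorff X_sigma_compact mu_radon.
Let mU := admissible_measurable U_adm.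
Let muU_fin i := admissible_measure_fin U_adm i mu_radon.
Let I_countable := admissible_countable U_adm X_sigma_compact.

Let U_fin x : finite_set [set i | U i x].
Proof.
have [_ /(_ x)[V Vx fin] _ _] := U_adm; apply: sub_finite_set fin => i Uix.
by exists x; split=> //; exact: nbhs_singleton Vx.
Qed.

Let K_ge0 r x y : (0 <= K r x y)%E.
Proof. by have [UX _ _ _] := U_adm; exact: sup_kernel_ge0. Qed.

Let Kt_ge0 r x y : (0 <= Kt r x y)%E.
Proof. by have [UX _ _ _] := U_adm; exact: sup_kernel_ge0. Qed.

Let p_le r i x y : U i x -> ((aV (p r i) y)%:E <= K r y x)%E.
Proof. by move=> Uix; exact: sup_kernel_ge Uix (x_U i). Qed.

Let q_le r i x y : U i x -> ((aV (q r i) y)%:E <= Kt r x y)%E.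
Proof. by move=> Uix; exact: sup_kernel_ge Uix (x_U i). Qed.

Let mK r : measurable_fun [set: borel X * borel X]
  (fun z : borel X * borel X => K r z.1 z.2).
Proof. by have [] := psi_kernel r. Qed.

Let mKt r : measurable_fun [set: borel X * borel X]
  (fun z : borel X * borel X => Kt r z.1 z.2).
Proof. by have [] := psit_kernel r. Qed.

Let K_fin r : (Amnorm mu nu (K r) < +oo)%E.
Proof. by have [] := psi_kernel r. Qed.

Let Kt_fin r : (Amnorm mu nu (Kt r) < +oo)%E.
Proof. by have [] := psit_kernel r. Qed.

Let q_H1 r i : H1 (q r i).
Proof.
exact: (H1_dual_atom phi_parseval nu_weight mU D_gt0 DU (Kt_ge0 r) (mKt r)
  (Kt_fin r) (@q_le r)).
Qed.

(** One constant for all the families, obtained by adding up theirs. *)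
Let atoms_bound : exists2 C : R, 0 <= C & forall r (J : {fset I}) h,
  (\sum_(i <- J) H1enorm (q r i) * \int[mu]_y (aV h y * aV (p r i) y)%:E
     <= C%:E * H1enorm h)%E.
Proof.
have [N UN] := admissible_overlap (R := R) U_adm.
have /choice[C CP] : forall r, exists C : R, 0 <= C /\
    forall (J : {fset I}) h,
    (\sum_(i <- J) H1enorm (q r i) * \int[mu]_y (aV h y * aV (p r i) y)%:E
     <= C%:E * H1enorm h)%E.
  move=> r; have [A A0 qA] := H1enorm_dual_atom phi_parseval nu_weight
    (Kt_ge0 r) (mKt r) (Kt_fin r) (@q_le r).
  have [C C0 CP] := atoms_sum_bound mu_sf phi_parseval nu_weight mU UN D_gt0 DU
    (K_ge0 r) (mK r) (K_fin r) (@p_le r) A0 qA.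
  by exists C.
have C0 : 0 <= \sum_r C r by apply: sumr_ge0 => r _; have [] := CP r.
exists (\sum_r C r) => // r J h; apply: le_trans ((CP r).2 J h) _.
rewrite lee_wpmul2r ?H1enorm_ge0// lee_fin (bigD1 r)//= lerDl.
by apply: sumr_ge0 => j _; have [] := CP j.
Qed.

Let expansion u h : (fun J : {fset I} =>
    \sum_r \sum_(i <- J) dot u (q r i) * dot (p r i) h) @ totally
  --> (dot u h : R[i]^o).
Proof. exact: expands_H_dot. Qed.

Let P := expansion_part dot p q.

Let P_cvg f r h : antidual f -> H1 h ->
  (fun J : {fset I} => \sum_(i <- J) f (q r i) * dot (p r i) h) @ totally
    --> (P f r h : R[i]^o).
Proof.
have [C C0 CP] := atoms_bound.
exact: (expansion_part_cvg dot_norm phi_parseval nu_weight CB_gt0 phi_bound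
  q_H1 C0 CP).
Qed.

Let P_antidual f r : antidual f -> antidual (P f r).
Proof.
have [C C0 CP] := atoms_bound.
exact: (expansion_part_antidual dot_norm phi_parseval nu_weight CB_gt0 phi_bound
  q_H1 C0 CP).
Qed.

Let P_sum f h : antidual f -> H1 h -> f h = \sum_r P f r h.
Proof.
have [C C0 CP] := atoms_bound.
exact: (expansion_part_sum dot_norm phi_parseval nu_weight CB_gt0 phi_bound
  I_countable q_H1 C0 CP expansion).
Qed.

Lemma antidual_expands_weakstar f : antidual f ->
  expands_weakstar mu dot psi psit x_ phi nu f.
Proof.
move=> fA; exists (P f); split=> [r|r h hH|h hH].
- exact: P_antidual.
- by rewrite (funext (fun J => dot_partial_sum dot psi psit x_ f r J h)); exact: P_cvg.
- exact: P_sum.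
Qed.

(** The coefficient at [i] is the pairing of [f] with an atom whose voice
transform is dominated by the row of the adjoint kernel at any point of [U i]. *)
Let coefficients_bound r : exists2 C : R, 0 <= C & forall f, coorbit f ->
  natural_space U Y (fun i => f (q r i)) /\
  natural_norm U Y (fun i => f (q r i)) <= C * coorbit_norm phi Y f.
Proof.
have [_ _ Kt_bounded] := psit_kernel r.
have [N UN] := admissible_overlap (R := R) U_adm.
have [C0 C0_ge0 C0P] := atoms_bound.
have [C C_ge0 CP] := natural_space_analysis Y_solid I_countable mU UN U_fin D_gt0
  DU muU_fin (Kt_ge0 r) (mKt r)
  (kernel_ae_fin nu_weight (Kt_ge0 r) (mKt r) (Kt_fin r)) Kt_bounded.
exists C => // f [fA Yf]; apply: CP => // i x Uix.
have fle := antidual_abs_le dot_norm phi_parseval nu_weight CB_gt0 phi_bound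
  I_countable phi_H1 q_H1 C0P expansion fA (qbf_measurable Yf) (q_H1 r i).
apply: le_trans fle _.
have mf : measurable_fun [set: borel X] (fun y => cabs (f (phi y))).
  exact: measurable_cabs (qbf_measurable Yf).
apply: le_integralT.
- by apply/measurable_EFinP/measurable_funM => //; exact: voice_abs_measurable.
- apply: emeasurable_funM; first exact/measurable_EFinP.
  exact: measurable_kernel_row.
- by move=> y; rewrite lee_fin mulr_ge0 ?cabs_ge0.
- by move=> y; rewrite EFinM lee_wpmul2l ?q_le// lee_fin cabs_ge0.
Qed.

Let series_bound r : exists2 C : R, 0 <= C &
  forall l F, natural_space U Y l ->
    (forall y, (fun J : {fset I} => \sum_(i <- J) l i * dot (p r i) (phi y))
      @ totally --> (F y : R[i]^o)) ->
    Y F /\ qnorm Y F <= C * natural_norm U Y l.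
Proof.
have [_ _ K_bounded] := psi_kernel r.
have [C C_ge0 CP] := natural_space_synthesis Y_solid I_countable mU U_fin D_gt0 DU
  muU_fin (K_ge0 r) (mK r)
  (kernel_ae_fin nu_weight (K_ge0 r) (mK r) (K_fin r)) K_bounded.
exists C => // l F Yl lF.
apply: (CP l (fun i y => dot (p r i) (phi y))) => // [i|i x y Uix].
  exact: (voice_cmeasurable phi_parseval).
exact: p_le.
Qed.

Let voice_P_space f r : antidual f -> natural_space U Y (fun i => f (q r i)) ->
  Y (voice phi (P f r)).
Proof.
move=> fA fN; have [C _ CP] := series_bound r.
by apply: (CP _ _ fN _).1 => y; exact: P_cvg.
Qed.

Let voice_sum f : antidual f ->
  voice phi f = fun y => \sum_r voice phi (P f r) y.
Proof. by move=> fA; apply/funext => y; rewrite /voice -P_sum. Qed.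

Lemma coorbit_natural_spaceP f : antidual f ->
  coorbit f <-> forall r, natural_space U Y (fun i => f (psit r (x_ i))).
Proof.
move=> fA; split=> [fC r|fN].
  by have [C _ CP] := coefficients_bound r; exact: (CP f fC).1.
have [C _ CP] := qbf_sum Y (index_enum 'I_n).
split=> //; rewrite voice_sum//; apply: (CP _ _).1 => r.
exact: voice_P_space fA (fN r).
Qed.

Lemma coorbit_norm_equiv : exists c C : R, [/\ 0 < c, 0 < C &
  forall f, coorbit f ->
    let s := \sum_r natural_norm U Y (fun i => f (psit r (x_ i))) in
    c * coorbit_norm phi Y f <= s /\ s <= C * coorbit_norm phi Y f].
Proof.
have /choice[Ca CaP] : forall r, exists C : R, 0 <= C /\
    forall f, coorbit f ->
      natural_norm U Y (fun i => f (q r i)) <= C * coorbit_norm phi Y f.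
  move=> r; have [C C0 CP] := coefficients_bound r; exists C; split=> // f fC.
  exact: (CP f fC).2.
have /choice[Cs CsP] : forall r, exists C : R, 0 <= C /\
    forall f, coorbit f ->
      qnorm Y (voice phi (P f r)) <= C * natural_norm U Y (fun i => f (q r i)).
  move=> r; have [C C0 CP] := series_bound r; exists C; split=> // f fC.
  have fN := (coorbit_natural_spaceP fC.1).1 fC r.
  by apply: (CP _ _ fN _).2 => y; exact: P_cvg fC.1 _.
have [B B0 BP] := qbf_sum Y (index_enum 'I_n).
pose S := B * \sum_r Cs r.
have S0 : 0 <= S by rewrite mulr_ge0// sumr_ge0// => r _; exact: (CsP r).1.
have A0 : 0 <= \sum_r Ca r by apply: sumr_ge0 => r _; exact: (CaP r).1.
(* adding 1 keeps the constants positive, also when there are no families *)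
exists (1 + S)^-1, (1 + \sum_r Ca r); split=> [||f fC s].
- by rewrite invr_gt0 ltr_pwDl.
- by rewrite ltr_pwDl.
have fA := fC.1; have fN := (coorbit_natural_spaceP fA).1 fC.
have nn0 r : 0 <= natural_norm U Y (fun i => f (q r i)) := qnorm_ge0 (fN r).
have s0 : 0 <= s by apply: sumr_ge0 => r _; exact: nn0.
have f0 : 0 <= coorbit_norm phi Y f := qnorm_ge0 fC.2.
split.
- rewrite mulrC ler_pdivrMr ?ltr_pwDl// /coorbit_norm voice_sum//.
  apply: le_trans (BP _ (fun r => voice_P_space fA (fN r))).2 _.
  apply: le_trans (_ : S * s <= _); last by rewrite mulrC ler_wpM2l// lerDr.
  rewrite /S -mulrA ler_wpM2l// mulr_sumr; apply: ler_sum => r _.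
  apply: le_trans ((CsP r).2 f fC) _; apply: ler_wpM2r (nn0 r) _ _ _.
  by rewrite (bigD1 r)//= lerDl sumr_ge0// => j _; exact: (CsP j).1.
- rewrite mulrDl mul1r mulr_suml /s.
  apply: le_trans (_ : \sum_r Ca r * coorbit_norm phi Y f <= _).
    by apply: ler_sum => r _; exact: (CaP r).2.
  by rewrite lerDr.
Qed.

(** The remainder of each inner series is the series of the truncated
coefficients, so that the synthesis bound reduces its norm to a norm in the
sequence space. *)
Lemma coorbit_expands f : finite_sequences_dense U Y -> coorbit f ->
  expands_coorbit dot psi psit x_ phi nu Y f.
Proof.
move=> dense fC; have fA := fC.1; have fN := (coorbit_natural_spaceP fA).1 fC.
pose l r i := f (q r i).
pose trunc r (J : {fset I}) i := if i \in J then l r i else 0.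
pose S r J := partial_sum (expansion_term psi psit x_ f r) J.
have trunc_cvg r J y : (fun J' : {fset I} =>
    \sum_(i <- J') trunc r J i * dot (p r i) (phi y)) @ totally -->
    (dot (S r J) (phi y) : R[i]^o).
  by rewrite dot_partial_sum; exact: ccvg_truncated.
have truncN r J : natural_space U Y (trunc r J).
  apply: (natural_space_le Y_solid I_countable mU U_fin _ (fN r)).1 => i.
  by rewrite /trunc; case: ifP => // _; rewrite cabs0 cabs_ge0.
exists (P f); split=> [r|r J|r|h hH].
- by split; [exact: P_antidual|exact: voice_P_space fA (fN r)].
- split; first exact: (dot_antidual dot_norm phi_parseval nu_weight CB_gt0 phi_bound).
  by have [C _ CP] := series_bound r; exact: (CP _ _ (truncN r J) (trunc_cvg r J)).1.
- have [C C0 CP] := series_bound r.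
  apply/cvgrPdist_le => e e0; have C1 : 0 < C + 1 by rewrite ltr_wpDl.
  have := natural_space_tail Y_solid I_countable mU U_fin dense (fN r)
    (divr_gt0 e0 C1).
  apply: filterS => J [tailN tail_e].
  have F_cvg y : (fun J' : {fset I} =>
      \sum_(i <- J') (l r i - trunc r J i) * dot (p r i) (phi y)) @ totally
      --> (voice phi (fun h => P f r h - dot (S r J) h) y : R[i]^o).
    have -> : (fun J' : {fset I} =>
          \sum_(i <- J') (l r i - trunc r J i) * dot (p r i) (phi y)) =
        fun J' : {fset I} =>
          -1 * \sum_(i <- J') trunc r J i * dot (p r i) (phi y) +
          \sum_(i <- J') l r i * dot (p r i) (phi y).
      apply/funext => J'; rewrite mulN1r addrC -sumrB.
      by apply: eq_bigr => i _; rewrite mulrBl.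
    rewrite (_ : voice _ _ y = -1 * dot (S r J) (phi y) + P f r (phi y)).
      by apply: ccvg_lin; [exact: trunc_cvg|exact: P_cvg].
    by rewrite mulN1r addrC.
  have [YF nF] := CP _ _ tailN F_cvg.
  rewrite sub0r normrN ger0_norm; last exact: qnorm_ge0 YF.
  apply: le_trans nF _; apply: le_trans (_ : C * (e / (C + 1)) <= _).
    by apply: ler_wpM2l => //; exact: ltW.
  by rewrite mulrA ler_pdivrMr// mulrC ler_wpM2l ?(ltW e0)// lerDl.
- exact: P_sum.
Qed.

End atomic_decomposition.

Theorem theorem2p50 (R : realType) (X : ptopologicalType)
  (mu : {measure set (borel X) -> \bar R})
  (H : completeNormedModType R[i]) (dot : {dot H for (fun z : R[i] => z^*)})
  (phi : borel X -> H) (nu : borel X -> R) (Y : qbf_space mu)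
  (n : nat) (psi psit : 'I_n -> borel X -> H)
  (I : choiceType) (U : I -> set X) (D : R) (x_ : I -> X) :
  hausdorff_space X -> locally_compact [set: X] -> sigma_compact X ->
  radon_measure mu -> measure_support mu = [set: X] ->
  separable_hilbert_space dot ->
  parseval_frame mu dot phi ->
  (forall x, H1 mu dot phi nu (phi x)) ->
  rich Y -> solid Y ->
  property_F dot phi nu Y ->
  admissible_covering U ->
  0 < D -> (forall i, (D%:E <= mu (U i))%E) ->
  (forall r, in_BYm Y nu (sup_kernel dot U (psi r) phi)) ->
  (forall r, in_BYm Y nu (sup_kernel_adj dot U (psit r) phi)) ->
  (forall i, U i (x_ i)) ->
  (forall f : H, expands_H dot psi psit x_ f) ->
  [/\ forall f, coorbit dot phi nu Y f ->
        expands_weakstar mu dot psi psit x_ phi nu f,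
      forall f, antidual mu dot phi nu f ->
        coorbit dot phi nu Y f <->
        (forall r, natural_space U Y (fun i => f (psit r (x_ i)))),
      exists c C : R, [/\ 0 < c, 0 < C &
        forall f, coorbit dot phi nu Y f ->
          let s := \sum_r natural_norm U Y (fun i => f (psit r (x_ i))) in
          c * coorbit_norm phi Y f <= s /\ s <= C * coorbit_norm phi Y f] &
      finite_sequences_dense U Y ->
        forall f, coorbit dot phi nu Y f ->
          expands_coorbit dot psi psit x_ phi nu Y f].
Proof.
move=> X_hausdorff _ X_sigma_compact mu_radon _ [dot_norm _] phi_parseval phi_H1.
move=> _ Y_solid [nu_weight [[CB CB_gt0 phi_bound] _] _ _] U_adm D_gt0 DU.
move=> psi_kernel psit_kernel x_U expansion_H; split.
- move=> f [fA _]; exact: (antidual_expands_weakstar X_hausdorff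
    X_sigma_compact mu_radon dot_norm phi_parseval nu_weight
    CB_gt0 phi_bound U_adm D_gt0 DU psi_kernel psit_kernel x_U expansion_H fA).
- move=> f fA; exact: (coorbit_natural_spaceP X_hausdorff
    X_sigma_compact mu_radon dot_norm phi_parseval phi_H1 Y_solid nu_weight
    CB_gt0 phi_bound U_adm D_gt0 DU psi_kernel psit_kernel x_U expansion_H fA).
- exact: (coorbit_norm_equiv X_hausdorff
    X_sigma_compact mu_radon dot_norm phi_parseval phi_H1 Y_solid nu_weight
    CB_gt0 phi_bound U_adm D_gt0 DU psi_kernel psit_kernel x_U expansion_H).
- move=> dense f fC; exact: (coorbit_expands X_hausdorff
    X_sigma_compact mu_radon dot_norm phi_parseval phi_H1 Y_solid nu_weight
    CB_gt0 phi_bound U_adm D_gt0 DU psi_kernel psit_kernel x_U expansion_H dense fC).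
Qed.
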